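(* Let $W$ be a graphon with $\sup_{x,y\in[0,1]}W(x,y)<1$ that is block-increasing or block-Lipschitz. Then there exists a constant $c=c(W)>0$ such that for any fixed $k\in\mathbb{N}$, with high probability (i.e. with probability tending to $1$ as $n\to\infty$), $$\chi(\boldsymbol{G})\ge(\varphi_k(W)-c/k)\frac{n}{2\log n},\qquad\text{where }\boldsymbol{G}\sim\mathcal{G}(n,W).$$
   Context: A graphon is a symmetric measurable function $W:[0,1]^2\to[0,1]$. It is block-increasing if there is a finite family $\mathcal{F}$ of disjoint intervals partitioning $[0,1]$ such that, for all $S,S'\in\mathcal{F}$, $W$ is increasing (in the weak sense, i.e. non-decreasing) in each coordinate on $S\times S'$. It is block-Lipschitz if there is such a finite family with $W$ Lipschitz on each $S\times S'$, $S,S'\in\mathcal{F}$. The random graph $\mathcal{G}(n,W)$ has vertex set $[n]=\{1,\dots,n\}$: sample $X_1,\dots,X_n$ independently and uniformly from $[0,1]$; conditionally on these, each edge $ij$ ($i\ne j$) is present independently with probability $W(X_i,X_j)$. $\chi(G)$ is the chromatic number, $\log$ is the natural logarithm, $\lambda$ is the Lebesgue (uniform) measure on $[0,1]$, and $\mathcal{P}([0,1])$ is the set of probability measures on $[0,1]$. $\mathcal{C}_\lambda$ is the set of pairs $(\mathcal{M},\boldsymbol{\alpha})$ where $\mathcal{M}\subset\mathcal{P}([0,1])$ is finite and $\boldsymbol{\alpha}=(\alpha_\mu)_{\mu\in\mathcal{M}}\in[0,1]^{|\mathcal{M}|}$ satisfies $\sum_{\mu\in\mathcal{M}}\alpha_\mu=1$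 and $\sum_{\mu\in\mathcal{M}}\alpha_\mu\mu=\lambda$. For $\mu\in\mathcal{P}([0,1])$, $$\varphi(\mu,W):=\sup_{S\subseteq[0,1]:\ \mu(S)>0}\frac1{\mu(S)}\int_S\int_S\log\Big(\frac1{1-W(x,y)}\Big)\,d\mu(x)\,d\mu(y)$$ (supremum over measurable $S$), and $$\varphi_k(W):=\inf_{(\mathcal{M},\boldsymbol{\alpha})\in\mathcal{C}_\lambda,\ |\mathcal{M}|\le k}\ \sum_{\mu\in\mathcal{M}}\alpha_\mu\varphi(\mu,W).$$ *)

(* Defs.v *)
From HB Require Import structures.
From mathcomp Require Import all_boot all_order all_algebra finmap.
From mathcomp Require Import all_classical all_reals all_analysis.

Set Implicit Arguments.
Unset Strict Implicit.
Unset Printing Implicit Defensive.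

Import Order.TTheory GRing.Theory Num.Theory.
Import numFieldNormedType.Exports.

Local Open Scope classical_set_scope.
Local Open Scope ring_scope.

Section simple_graphs.

Definition is_sgraph n (E : {set {set 'I_n}}) : bool :=
  [forall e in E, #|e| == 2%N].

Definition sgraph n := {E : {set {set 'I_n}} | is_sgraph E}.

Definition adj n (H : sgraph n) (i j : 'I_n) : bool :=
  [set i; j]%SET \in val H.

Definition colorable n (H : sgraph n) (k : nat) : bool :=
  [exists f : {ffun 'I_n -> 'I_k},
    [forall i, forall j, adj H i j ==> (f i != f j)]].

Lemma adj_irrefl n (H : sgraph n) i : adj H i i = false.
Proof.
apply/negP => Hii; have /forall_inP/(_ _ Hii) := valP H.
by rewrite finset.setUid cards1.
Qed.

Lemma colorable_order n (H : sgraph n) : exists k, colorable H k.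
Proof.
exists n; apply/existsP; exists [ffun i => i].
apply/forallP => i; apply/forallP => j; apply/implyP; rewrite !ffunE => Hij.
by apply/eqP => ij; rewrite ij adj_irrefl in Hij.
Qed.

Definition chromatic_number n (H : sgraph n) : nat :=
  ex_minn (colorable_order H).

End simple_graphs.

Section iid.
Context d (T : measurableType d) (R : realType).

Definition tcons n (z : T * n.-tuple T) : n.+1.-tuple T :=
  [tuple of z.1 :: z.2].

Lemma measurable_tcons n : measurable_fun [set: T * n.-tuple T] (@tcons n).
Proof. exact: measurable_cons. Qed.

HB.instance Definition _ n :=
  isMeasurableFun.Build _ _ _ _ (@tcons n) (@measurable_tcons n).

(* The n-fold product of P, i.e. the law of n independent samples from P. *)
Fixpoint iid_prob (P : probability T R) n : probability (n.-tuple T) R :=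
  match n with
  | 0%N => \d_([tuple] : 0.-tuple T)
  | m.+1 => distribution (P \x iid_prob P m)%E (@tcons m)
  end.

End iid.

Section graphons.
Variable R : realType.
Implicit Types (W : R * R -> R) (mu : probability (measurableTypeR R) R).

Local Notation I := (`[0, 1]%classic : set R).

(* A function on [0, 1]^2 is encoded by a function on R^2 whose values
   outside [0, 1]^2 are irrelevant. *)
Definition graphon W : Prop :=
  [/\ measurable_fun (I `*` I : set (measurableTypeR R * measurableTypeR R)) W,
      forall x y, I x -> I y -> W (x, y) = W (y, x)
    & forall x y, I x -> I y -> 0 <= W (x, y) <= 1].

(* Degenerate (one-point) intervals are allowed as blocks. *)
Definition interval_partition (F : set (set R)) : Prop :=
  [/\ finite_set F, partition F id I & forall S, F S -> is_interval S].

Definition nondecreasing_on W (S S' : set R) : Prop :=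
  (forall x1 x2 y, S x1 -> S x2 -> S' y -> x1 <= x2 -> W (x1, y) <= W (x2, y)) /\
  (forall x y1 y2, S x -> S' y1 -> S' y2 -> y1 <= y2 -> W (x, y1) <= W (x, y2)).

Definition block_increasing W : Prop :=
  exists2 F, interval_partition F &
    forall S S', F S -> F S' -> nondecreasing_on W S S'.

(* The norm on R * R is the max norm. *)
Definition block_lipschitz W : Prop :=
  exists2 F, interval_partition F &
    forall S S', F S -> F S' ->
      [lipschitz (W z : R^o) | z in (S `*` S' : set (R^o * R^o))].

Definition lambda01 : probability (measurableTypeR R) R :=
  uniform_prob (@ltr01 R).

(* The probability that the random graph is H, given that the vertex types are
   x_0, ..., x_(n-1). *)
Definition cond_mass W n (x : n.-tuple (measurableTypeR R)) (H : sgraph n) : R :=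
  \prod_(i < n) \prod_(j < n | (i < j)%N)
    (if adj H i j then W (tnth x i, tnth x j) else 1 - W (tnth x i, tnth x j)).

(* The probability that the random graph G(n, W) belongs to A. The samples lie
   in [0, 1] almost surely; the domain of integration avoids the irrelevant
   values of W. *)
Definition Gnw_prob W n (A : {set sgraph n}) : \bar R :=
  \int[iid_prob lambda01 n]_(x in [set x | forall i, I (tnth x i)])
    (\sum_(H in A) cond_mass W x H)%:E.

Local Open Scope ereal_scope.

(* log (1 / (1 - W)), which is +oo where W = 1. *)
Definition log_kernel W (z : R * R) : \bar R := lne ((1 - W z)%:E^-1).

Definition phi mu W : \bar R :=
  ereal_sup [set (mu S)^-1 * \int[mu]_(x in S) \int[mu]_(y in S) log_kernel W (x, y)
            | S in [set S | [/\ measurable S, S `<=` I & 0 < mu S]]].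

Definition C_lambda (M : {fset probability (measurableTypeR R) R})
    (a : probability (measurableTypeR R) R -> R) : Prop :=
  [/\ forall mu, mu \in M -> mu I = 1,
      forall mu, mu \in M -> (0 <= a mu <= 1)%R,
      (\sum_(mu <- M) a mu = 1)%R
    & forall A, measurable A -> \sum_(mu <- M) (a mu)%:E * mu A = lambda01 A].

Definition phik (k : nat) W : \bar R :=
  ereal_inf [set s | exists M a, [/\ C_lambda M a, (#|` M| <= k)%N
                                   & s = \sum_(mu <- M) (a mu)%:E * phi mu W]].

End graphons.

(* Main.v *)
(* Let [K = log (1 / (1 - W))], cut [0, 1] into [k] blocks of length [1 / k], and let
   [w a b] be the infimum of [K] over the product of blocks [a] and [b].

   First moment: given the vertex types, a vertex set [T] is independent with
   probability [exp (- sum of K over the pairs of T)], so a union bound over all [T] shows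
   that with high probability that sum is at most [(1 + eps) #|T| ln n] for every
   independent [T].  Apply this to the subsets of a colour class that are unions of its
   blocks: they are the corners of a box on which [t^T w t - V (sum of t)], with
   [V] about [2 ln n], is convex in each coordinate, hence nonpositive on the whole box.
   This says that the normalised profile [p] of the class, read as a step density,
   satisfies [phi p <= V / #|class|] for the step kernel [w].

   Since each block contains about [n / k] types, the profiles average to the uniform
   distribution (after decreasing the weights slightly) and the corresponding average of
   [phi] is about [chi V / n].  Caratheodory's theorem reduces the number of profiles to
   [k], the dimension of the space of profiles.

   It remains to return from [w] to [K], at a cost [O(1 / k)].  Shifting each measure by
   one block to the left does it: both monotonicity and the Lipschitz condition bound [K]
   on the product of blocks [a] and [b] by [w (a + 1) (b + 1) + O(1 / k)], except when [a]
   or [b] belongs to a set of [O(1)] blocks, whose total mass is [O(1 / k)]. *)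

From HB Require Import structures.
Require Import Defs.
From mathcomp Require Import all_boot all_order all_algebra finmap.
From mathcomp Require Import all_classical all_reals all_analysis.
From mathcomp Require Import measurable_realfun.
From mathcomp Require Import ring lra zify.

Set Implicit Arguments.
Unset Strict Implicit.
Unset Printing Implicit Defensive.

Import Order.TTheory GRing.Theory Num.Theory.
Import numFieldNormedType.Exports.

Local Open Scope classical_set_scope.
Local Open Scope ring_scope.

(** * Graphs and their conditional mass *)

Section pairs.
Variable n : nat.
Implicit Types (p : 'I_n * 'I_n) (H : sgraph n) (T : {set 'I_n}).

Definition pair_edge p : {set 'I_n} := [set p.1; p.2]%SET.

Lemma pair_edge_inj :
  {in [pred p : 'I_n * 'I_n | (p.1 < p.2)%N] &, injective pair_edge}.
Proof.
move=> [i j] [i' j']; rewrite !inE /= => ij i'j' /setP e.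
have := e i; have := e j; have := e i'; have := e j'.
rewrite !inE !eqxx ?orbT /=.
move=> /orP[]/eqP ? /orP[]/eqP ? /esym/orP[]/eqP ? /esym/orP[]/eqP ?; subst=> //; lia.
Qed.

Lemma card2_pair_edge (e : {set 'I_n}) :
  (#|e| == 2)%N = (e \in pair_edge @: [pred p : 'I_n * 'I_n | (p.1 < p.2)%N]).
Proof.
apply/idP/imsetP => [/cards2P[i [j [ij ->]]]|[[i j]]]; last first.
  by rewrite inE /= => ij ->; rewrite cards2 neq_ltn ij.
move: ij; rewrite neq_ltn => /orP[ij|ij].
  by exists (i, j).
by exists (j, i) => //; rewrite /pair_edge finset.setUC.
Qed.

Variable S : comNzRingType.
Implicit Types f g : 'I_n -> 'I_n -> S.

Lemma prod_card2 (X : {set 'I_n} -> S) :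
  \prod_(e : {set 'I_n} | (#|e| == 2)%N) X e =
  \prod_(i < n) \prod_(j < n | (i < j)%N) X [set i; j]%SET.
Proof.
rewrite pair_big_dep /=.
under eq_bigl => e do rewrite card2_pair_edge.
by rewrite big_imset //; exact: pair_edge_inj.
Qed.

(** A graph is a set of pairs, so this is the distributive law for a product of binomials over the
    pairs. *)
Lemma sum_sgraph_prod f g :
  \sum_(H : sgraph n) \prod_(i < n) \prod_(j < n | (i < j)%N)
     (if adj H i j then f i j else g i j) =
  \prod_(i < n) \prod_(j < n | (i < j)%N) (f i j + g i j).
Proof.
(* The distributive law ranges over all families of vertex sets. Extending [f] by 0 and [g] by 1
   outside the pairs turns each non-pair into a factor [0 + 1] and kills every family that is not a
   graph. *)
pose ext (c : S) (h : 'I_n -> 'I_n -> S) (e : {set 'I_n}) :=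
  if [pick p : 'I_n * 'I_n | (p.1 < p.2)%N && (pair_edge p == e)]
    is Some p then h p.1 p.2 else c.
have extE c h (i j : 'I_n) : (i < j)%N -> ext c h [set i; j]%SET = h i j.
  move=> ij; rewrite /ext; case: pickP => [p /andP[pp /eqP pe]|].
    have /= := @pair_edge_inj p (i, j) pp ij.
    by move=> ->.
  by move=> /(_ (i, j)); rewrite /= ij eqxx.
have extN c h (e : {set 'I_n}) : (#|e| != 2)%N -> ext c h e = c.
  rewrite /ext; case: pickP => [p /andP[pp /eqP <-]|//].
  by rewrite card2_pair_edge imset_f.
transitivity (\prod_(e : {set 'I_n}) (ext 0 f e + ext 1 g e)); last first.
  rewrite (bigID (fun e : {set 'I_n} => (#|e| == 2)%N)) /= [X in _ * X]big1 ?mulr1.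
    rewrite prod_card2; apply: eq_bigr => i _; apply: eq_bigr => j ij.
    by rewrite !extE.
  by move=> e e2; rewrite !extN // add0r.
rewrite bigA_distr /= [RHS](bigID (@is_sgraph n)) /= [X in _ + X]big1 ?addr0.
  have s0 : is_sgraph (finset.set0 : {set {set 'I_n}}).
    by apply/forall_inP => e; rewrite inE.
  rewrite (reindex_onto (val : sgraph n -> _)
    (insubd (exist _ finset.set0 s0 : sgraph n))) /=; last first.
    by move=> E sE; rewrite insubdK.
  rewrite [RHS](eq_bigl predT) => [|H]; last first.
    by rewrite valKd eqxx andbT; exact: (valP H).
  apply: eq_bigr => H _; rewrite [RHS](bigID (fun e : {set 'I_n} => (#|e| == 2)%N)) /=.
  rewrite [X in _ * X]big1 ?mulr1 => [|e e2]; last first.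
    rewrite !extN //; case: ifP => // eH.
    by have /forall_inP/(_ _ eH) := valP H; rewrite (negbTE e2).
  rewrite prod_card2; apply: eq_bigr => i _; apply: eq_bigr => j ij.
  by rewrite !extE.
move=> E; rewrite /is_sgraph negb_forall_in => /exists_inP[e eE e2].
by rewrite (bigD1 e) //= eE extN // mul0r.
Qed.

End pairs.

Definition independent n (H : sgraph n) (T : {set 'I_n}) : bool :=
  [forall i in T, forall j in T, ~~ adj H i j].

Section cond_mass.
Variables (R : realType) (W : R * R -> R) (n : nat).
Variable x : n.-tuple (measurableTypeR R).
Let w i j := W (tnth x i, tnth x j).

Lemma sum_cond_mass : \sum_(H : sgraph n) cond_mass W x H = 1.
Proof.
rewrite /cond_mass (sum_sgraph_prod w (fun i j => 1 - w i j)).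
by rewrite big1 // => i _; rewrite big1 // => j _; rewrite addrC subrK.
Qed.

Lemma adjC (H : sgraph n) i j : adj H i j = adj H j i.
Proof. by rewrite /adj finset.setUC. Qed.

(** Replacing the edge probability by 0 inside [T] removes the graphs with an edge in [T] and leaves
    the mass of the others unchanged; the total then factorises over the pairs. *)
Lemma sum_cond_mass_independent (T : {set 'I_n}) :
  \sum_(H : sgraph n | independent H T) cond_mass W x H =
  \prod_(i < n) \prod_(j < n | (i < j)%N)
    (if (i \in T) && (j \in T) then 1 - w i j else 1).
Proof.
transitivity (\sum_(H : sgraph n) \prod_(i < n) \prod_(j < n | (i < j)%N)
    (if adj H i j then (if (i \in T) && (j \in T) then 0 else w i j)
     else 1 - w i j)); last first.
  rewrite sum_sgraph_prod; apply: eq_bigr => i _; apply: eq_bigr => j _.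
  by case: ifP; rewrite ?add0r // addrC subrK.
rewrite [RHS](bigID (fun H => independent H T)) /= [X in _ = _ + X]big1 ?addr0; last first.
  move=> H; rewrite /independent negb_forall_in => /exists_inP[i iT].
  rewrite negb_forall_in => /exists_inP[j jT]; rewrite negbK => ij.
  wlog lij : i j iT jT ij / (i < j)%N.
    move=> wl; have [ltij|ltji|/val_inj eij] := ltngtP i j; first exact: (wl i j).
      by apply: (wl j i) => //; rewrite adjC.
    by rewrite eij adj_irrefl in ij.
  by rewrite (bigD1 i) //= (bigD1 j) //= ij iT jT /= !mul0r.
apply: eq_bigr => H /forall_inP indH; apply: eq_bigr => i _; apply: eq_bigr => j _.
case: ifP => // aij; case: ifP => // /andP[iT jT].
by have /forall_inP/(_ _ jT) := indH i iT; rewrite aij.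
Qed.

Lemma cond_mass_ge0 (H : sgraph n) :
  (forall i j, 0 <= w i j <= 1) -> 0 <= cond_mass W x H.
Proof.
move=> w01; apply: prodr_ge0 => i _; apply: prodr_ge0 => j _.
by have /andP[w0 w1] := w01 i j; case: ifP => _; rewrite ?subr_ge0.
Qed.

End cond_mass.

Lemma chromatic_number_coloring n (H : sgraph n) :
  exists f : 'I_n -> 'I_(chromatic_number H),
    forall i j, adj H i j -> f i != f j.
Proof.
rewrite /chromatic_number; case: ex_minnP => m /existsP[f /forallP fP] _.
by exists f => i j ij; have /forallP/(_ j)/implyP/(_ ij) := fP i.
Qed.

(** * Convex geometry in the space of profiles *)

Section convex_reduction.
Variables (R : realFieldType) (k : nat) (J : finType).
Variables (P : J -> 'I_k -> R) (v : J -> R).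

(** The profiles indexed by [A] are the rows of a matrix with more rows than columns, so its left
    kernel is nonzero. *)
Lemma linear_dependency (A : {set J}) : (k < #|A|)%N ->
  exists c : J -> R, [/\ forall j, j \notin A -> c j = 0,
    exists2 j, j \in A & c j != 0
    & forall a, \sum_j c j * P j a = 0].
Proof.
move=> kA.
pose M : 'M[R]_(#|A|, k) := \matrix_(i, a) P (enum_val i) a.
have : kermx M != 0.
  rewrite -mxrank_eq0 mxrank_ker subn_eq0 -ltnNge.
  exact: leq_ltn_trans (rank_leq_col M) kA.
case/rowV0Pn => u /sub_kermxP uM u0.
have [i ui] : exists i, u 0 i != 0.
  apply/existsP; apply: contraR u0; rewrite negb_exists => /forallP u0.
  by apply/eqP/rowP => i; rewrite mxE; apply/eqP; rewrite -[_ == _]negbK u0.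
have jA : enum_val i \in A by exact: enum_valP.
pose c j := if j \in A then u 0 (enum_rank_in jA j) else 0.
have cE i' : c (enum_val i') = u 0 i'.
  by rewrite /c enum_valP enum_valK_in.
exists c; split => [j jNA||a].
- by rewrite /c (negbTE jNA).
- by exists (enum_val i) => //; rewrite cE.
- rewrite (bigID (mem A)) /= [X in _ + X]big1 ?addr0; last first.
    by move=> j jNA; rewrite /c (negbTE jNA) mul0r.
  rewrite (reindex_omap enum_val (fun j => Some (enum_rank_in jA j))) /=; last first.
    by move=> j jA'; rewrite enum_rankK_in.
  under eq_bigl => i' do rewrite enum_valP enum_valK_in eqxx.
  have /rowP/(_ a) := uM; rewrite !mxE => uMa; rewrite -[RHS]uMa.
  by apply: eq_bigr => i' _; rewrite cE !mxE.
Qed.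

(** While more than [k] weights are nonzero, move them along a linear dependency, in the direction
    that does not increase the value, until one more weight vanishes. The profiles lie in the
    hyperplane of sum 1, which is why [k] of them suffice rather than [k + 1]. *)
Lemma caratheodory (al : J -> R) :
  (forall j, 0 <= al j) -> (forall j, al j != 0 -> \sum_a P j a = 1) ->
  exists be : J -> R, [/\ forall j, 0 <= be j,
    forall j, al j = 0 -> be j = 0,
    forall a, \sum_j be j * P j a = \sum_j al j * P j a,
    \sum_j be j * v j <= \sum_j al j * v j
    & (#|[set j | be j != 0%R]%SET| <= k)%N].
Proof.
have [m] := ubnP #|[set j | al j != 0%R]%SET|.
elim: m al => // m IH al alm al0 P1.
have [le_k|gt_k] := leqP #|[set j | al j != 0%R]%SET| k; first by exists al.
have [c [cN [j0 j0A cj0] cP]] := linear_dependency gt_k.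
wlog cv : c cN cj0 cP / \sum_j c j * v j <= 0.
  move=> wl; have [|cv] := leP (\sum_j c j * v j) 0; first exact: wl.
  apply: (wl (fun j => - c j)).
  - by move=> j /cN ->; rewrite oppr0.
  - by rewrite oppr_eq0.
  - move=> a; under eq_bigr do rewrite mulNr.
    by rewrite sumrN cP oppr0.
  - under eq_bigr do rewrite mulNr.
    by rewrite sumrN oppr_le0 ltW.
(* The profiles in the support of [c] have sum 1, so summing the dependency over the coordinates
   gives this. Hence some coefficient is negative and the move has to stop. *)
have c0 : \sum_j c j = 0.
  transitivity (\sum_j \sum_a c j * P j a).
    apply: eq_bigr => j _; rewrite -mulr_sumr.
    have [/eqP alj|alj] := boolP (al j == 0); last by rewrite P1 // mulr1.
    by rewrite cN ?mul0r // inE alj eqxx.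
  by rewrite exchange_big /= big1.
have [j1 cj1] : exists j, c j < 0.
  apply/existsP; apply: contraR cj0; rewrite negb_exists => /forallP cpos.
  have cge j : 0 <= c j by rewrite leNgt cpos.
  have/eqP := c0; rewrite psumr_eq0 => [/allP/(_ j0)|j _]; last exact: cge.
  by rewrite mem_index_enum; exact.
(* The longest move that keeps all weights nonnegative; it brings the weight of [j2] to 0. *)
case: (@arg_minP _ _ _ j1 (fun j => c j < 0) (fun j => al j / - c j) cj1) => j2 cj2 j2min.
pose s := al j2 / - c j2.
have s0 : 0 <= s by rewrite divr_ge0 // oppr_ge0 ltW.
pose be j := al j + s * c j.
have be0 j : 0 <= be j.
  rewrite /be; have [cj|cj] := leP 0 (c j); first exact: addr_ge0 (al0 j) (mulr_ge0 s0 cj).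
  by have := j2min _ cj; rewrite -/s ler_pdivlMr ?oppr_gt0 // mulrN -subr_ge0 opprK.
have beal j : al j = 0 -> be j = 0.
  by move=> alj; rewrite /be alj cN ?mulr0 ?addr0 // inE alj eqxx.
have al2 : al j2 != 0.
  by apply/negP => /eqP alj; move: cj2; rewrite cN ?ltxx // inE alj eqxx.
have be2 : be j2 = 0.
  by rewrite /be /s; field; rewrite lt_eqF.
have beP a : \sum_j be j * P j a = \sum_j al j * P j a.
  under eq_bigr do rewrite mulrDl -mulrA.
  by rewrite big_split /= -mulr_sumr cP mulr0 addr0.
have bev : \sum_j be j * v j <= \sum_j al j * v j.
  under eq_bigr do rewrite mulrDl -mulrA.
  by rewrite big_split /= -mulr_sumr gerDl mulr_ge0_le0.
have [||ga [ga0 gabe gaP gav gak]] := IH be _ be0.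
- rewrite -ltnS; apply: leq_trans alm; rewrite ltnS; apply: proper_card.
  apply/properP; split; last by exists j2; rewrite !inE ?be2 ?eqxx.
  by apply/fintype.subsetP => j; rewrite !inE; apply: contra => /eqP/beal->.
- by move=> j bej; apply: P1; apply: contra bej => /eqP/beal->.
exists ga; split => // [j /beal/gabe//|a|]; first by rewrite gaP.
exact: le_trans gav bev.
Qed.

End convex_reduction.

Section corner.
Variables (R : realFieldType) (k : nat) (w : 'I_k -> 'I_k -> R).

Definition quad (t : 'I_k -> R) := \sum_a \sum_b t a * t b * w a b.

(* The difference of the two sides is convex in each coordinate of [t]. *)
Lemma quad_le_corner (V : R) (s : 'I_k -> R) :
  (forall a, 0 <= w a a) -> (forall a, 0 <= s a) ->
  (forall A : {set 'I_k}, let t a := if a \in A then s a else 0 in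
    quad t <= V * \sum_a t a) ->
  forall t, (forall a, 0 <= t a <= s a) -> quad t <= V * \sum_a t a.
Proof.
move=> w0 s0 corner t.
(* Induction on the number of coordinates of [t] that are at neither end of their range. *)
have [m] := ubnP #|[set a | (t a != 0) && (t a != s a)]%SET|.
elim: m t => // m IH t tm ts.
have [/eqP|/finset.set0Pn[a]] :=
    boolP ([set a | (t a != 0) && (t a != s a)]%SET == finset.set0).
  move=> /setP t0; have := corner [set a | t a != 0]%SET.
  have -> : (fun a => if a \in [set a | t a != 0]%SET then s a else 0) = t; last by [].
  apply/funext => a; have := t0 a; rewrite !inE.
  by case: eqVneq => //= ? /negbFE/eqP.
rewrite inE => /andP[ta0 tas].
have [t0 tsa] := andP (ts a).
have sa0 : 0 < s a by apply: lt_le_trans tsa; rewrite lt_neqAle eq_sym ta0.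
pose upd x b := if b == a then x else t b.
pose A := \sum_(b | b != a) (w a b + w b a) * t b.
pose B := \sum_(b | b != a) \sum_(c | c != a) t b * t c * w b c.
pose C := \sum_(b | b != a) t b.
have sumE x : \sum_b upd x b = x + C.
  rewrite (bigD1 a) //= /upd eqxx; congr (_ + _).
  by apply: eq_bigr => b /negbTE ->.
have quadE x : quad (upd x) = x ^+ 2 * w a a + x * A + B.
  rewrite /quad (bigD1 a) //= (bigD1 a) //= {1 2}/upd eqxx -expr2 -!addrA.
  congr (_ + _).
  have -> : \sum_(i | i != a) \sum_b upd x i * upd x b * w i b =
      \sum_(i | i != a) (t i * x * w i a + \sum_(c | c != a) t i * t c * w i c).
    apply: eq_bigr => b ba; rewrite (bigD1 a) //=.
    rewrite /upd (negbTE ba) eqxx; congr (_ + _).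
    by apply: eq_bigr => c /negbTE ->.
  rewrite big_split /= addrA -/B; congr (_ + _).
  rewrite /A mulr_sumr -big_split /=; apply: eq_bigr => b ba.
  by rewrite /upd (negbTE ba) eqxx; ring.
have updt : t = upd (t a) by apply/funext => b; rewrite /upd; case: eqP => [->|].
have IHu x : (x == 0) || (x == s a) -> quad (upd x) <= V * \sum_b upd x b.
  move=> x0; apply: IH; last first.
    move=> b; rewrite /upd; case: eqP => [->|_]; last exact: ts.
    by case/orP: x0 => /eqP->; rewrite lexx ltW.
  rewrite -ltnS; apply: leq_trans tm; rewrite ltnS; apply: proper_card.
  apply/properP; split; last first.
    by exists a; rewrite !inE ?ta0 ?tas // /upd eqxx -negb_or negbK.
  apply/fintype.subsetP => b; rewrite !inE /upd; case: (b =P a) => // ->.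
  by rewrite -negb_or x0.
have := IHu 0; rewrite eqxx => /(_ isT).
have := IHu (s a); rewrite eqxx orbT => /(_ isT).
rewrite updt !quadE !sumE => h1 h2.
set x := t a in t0 tsa *; set S := s a in sa0 tsa h1 *.
have wa := w0 a.
(* Convexity in coordinate [a]: [x] is the average of [S] and 0 with weights [x / S] and
   [1 - x / S]. The inequalities that follow are multiplied by [S] to avoid the division. *)
have xS : x ^+ 2 * w a a <= x * S * w a a.
  by rewrite expr2 -!mulrA ler_wpM2l // ler_wpM2r.
have h1' : x * (S ^+ 2 * w a a + S * A + B) <= x * (V * (S + C)) by rewrite ler_wpM2l.
have h2' : (S - x) * (0 ^+ 2 * w a a + 0 * A + B) <= (S - x) * (V * (0 + C)).
  by rewrite ler_wpM2l // subr_ge0.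
rewrite -(ler_pM2l sa0).
have : S * (x ^+ 2 * w a a) <= S * (x * S * w a a) by rewrite ler_pM2l.
move: h1' h2'; rewrite !expr2; lra.
Qed.

End corner.

(** * Step measures *)

Section blocks.
Variable R : realType.
Local Notation I := (`[0, 1]%classic : set R).

(** Half-open, so that the blocks are disjoint, except for the last one, which must contain 1. *)
Definition block (k a : nat) : set R :=
  [set` Interval (BLeft (a%:R / k%:R))
          (if a.+1 == k then BRight 1 else BLeft (a.+1%:R / k%:R))].

Lemma measurable_block k a : measurable (block k a : set (measurableTypeR R)).
Proof. exact: measurable_itv. Qed.

Lemma block_bounds k a x : (a < k)%N -> block k a x ->
  a%:R / k%:R <= x <= a.+1%:R / k%:R.
Proof.
move=> ak; have k0 : k%:R != 0 :> R by rewrite pnatr_eq0 -lt0n (leq_ltn_trans _ ak).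
rewrite /block; case: eqP => [<-|_] /=; rewrite in_itv /= => /andP[-> x1] /=; last exact: ltW.
by rewrite divff // pnatr_eq0.
Qed.

Lemma blockE k a x : (a.+1 < k)%N ->
  block k a x <-> a%:R / k%:R <= x < a.+1%:R / k%:R.
Proof. by move=> ak; rewrite /block ltn_eqF //= in_itv. Qed.

Lemma block_I k a x : (a < k)%N -> block k a x -> I x.
Proof.
move=> ak /(block_bounds ak)/andP[ax xa].
have k0 : 0 < k%:R :> R by rewrite ltr0n (leq_ltn_trans _ ak).
rewrite /= in_itv /= (le_trans _ ax) ?divr_ge0 ?ler0n //=.
by rewrite (le_trans xa) // ler_pdivrMr // mul1r ler_nat.
Qed.

Lemma block_left k a : (a < k)%N -> block k a (a%:R / k%:R).
Proof.
move=> ak; have k0 : 0 < k%:R :> R by rewrite ltr0n (leq_ltn_trans _ ak).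
rewrite /block; case: eqP => _ /=; rewrite in_itv /= lexx /=.
  by rewrite ler_pdivrMr // mul1r ler_nat ltnW.
by rewrite ltr_pM2r ?invr_gt0 // ltr_nat.
Qed.

Lemma block_cover k x : (0 < k)%N -> I x -> exists a : 'I_k, block k a x.
Proof.
move=> k0 /=; rewrite in_itv /= => /andP[x0 x1].
have kR : 0 < k%:R :> R by rewrite ltr0n.
case: k k0 kR => // k _ kR.
have /andP[lo hi] := truncn_itv (mulr_ge0 x0 (ltW kR)).
set m := Num.truncn _ in lo hi.
have [mk|km] := ltnP m k.
  exists (inord m); rewrite inordK; last by rewrite ltnS ltnW.
  by apply/blockE; rewrite ?ltnS // ler_pdivrMr // lo ltr_pdivlMr.
exists ord_max; rewrite /block /= eqxx /= in_itv /= x1 andbT.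
by rewrite ler_pdivrMr // (le_trans _ lo) // ler_nat.
Qed.

Lemma block_lt k a b x y : (a < b)%N -> (b < k)%N ->
  block k a x -> block k b y -> x < y.
Proof.
move=> ab bk; have k0 : 0 < k%:R :> R by rewrite ltr0n (leq_ltn_trans _ bk).
have ak : (a.+1 < k)%N by apply: leq_ltn_trans bk.
move=> /(blockE _ ak)/andP[_ xa] /(block_bounds bk)/andP[+ _].
by apply: lt_le_trans; apply: lt_le_trans xa _; rewrite ler_pM2r ?invr_gt0 // ler_nat.
Qed.

Lemma trivIset_block k : trivIset [set: 'I_k] (fun a : 'I_k => block k a).
Proof.
apply/trivIsetP => a b _ _ ab; apply/seteqP; split => // x [xa xb].
wlog lt_ab : a b ab xa xb / (a < b)%N.
  move=> wl; move: (ab); rewrite neq_ltn => /orP[]; first exact: (wl a b).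
  by rewrite eq_sym in ab; exact: (wl b a).
by have := block_lt lt_ab (ltn_ord b) xa xb; rewrite ltxx.
Qed.

Lemma lambda01_block k (a : 'I_k) : lambda01 R (block k a) = (k%:R^-1)%:E.
Proof.
have ak := ltn_ord a.
have k0 : 0 < k%:R :> R by rewrite ltr0n (leq_ltn_trans _ ak).
rewrite /lambda01 /= /uniform_prob (eq_integral (fun=> 1%:E)); last first.
  move=> x; rewrite inE => /(block_I ak); rewrite /= in_itv /= /uniform_pdf => ->.
  by rewrite subr0 invr1.
rewrite integral_cst /=; last exact: measurable_block.
rewrite mul1e /block lebesgue_measure_itv /=; case: eqP => [ka|_] /=.
  rewrite lte_fin ltr_pdivrMr // mul1r ltr_nat ak -EFinB; congr EFin.
  have -> : k%:R = a%:R + 1 :> R by rewrite natr1; congr (_%:R).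
  by field; rewrite natr1 pnatr_eq0.
rewrite lte_fin ltr_pM2r ?invr_gt0 // ltr_nat leqnn -EFinB; congr EFin.
by rewrite -mulrBl -natrB // subSnn mul1r.
Qed.

Lemma lambda01_setI A : lambda01 R (A `&` I) = lambda01 R A.
Proof.
by rewrite /lambda01 /= /uniform_prob integral_uniform_pdf [RHS]integral_uniform_pdf
  -setIA setIid.
Qed.

Lemma measure_blocks (mu : {measure set (measurableTypeR R) -> \bar R}) k
    (A : set (measurableTypeR R)) :
  (0 < k)%N -> measurable A ->
  mu (A `&` I) = (\sum_(a < k) mu (A `&` block k a))%E.
Proof.
move=> k0 mA; rewrite -measure_bigsetU_ord //.
- congr (mu _); rewrite -bigcup_seq -setI_bigcupr; congr (_ `&` _).
  apply/seteqP; split => x; last by move=> [a _]; exact: block_I.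
  by move=> /(block_cover k0)[a xa]; exists a => //=; rewrite mem_index_enum.
- by move=> a; apply: measurableI => //; exact: measurable_block.
- by apply: trivIset_setIl; exact: trivIset_block.
Qed.

End blocks.

Section integral_blocks.
Local Open Scope ereal_scope.

(** The integral of a nonnegative function is a supremum over the simple functions below it, hence
    monotone for arbitrary functions. It serves for the inner integral of the kernel as a function
    of [x]. *)
Lemma ge0_le_integral_pointwise d (T : measurableType d) (R : realType)
    (mu : {measure set T -> \bar R}) (D : set T) (f g : T -> \bar R) :
  (forall x, D x -> 0 <= f x <= g x) ->
  \int[mu]_(x in D) f x <= \int[mu]_(x in D) g x.
Proof.
move=> fg; rewrite (integral_mkcond D f) (integral_mkcond D g).
have fg' x : 0 <= (f \_ D) x <= (g \_ D) x.
  by rewrite /patch; case: ifPn => [|_]; rewrite ?lexx // inE => /fg.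
rewrite !ge0_integralTE; last 2 first.
- by move=> x; have /andP[h1 h2] := fg' x; exact: le_trans h2.
- by move=> x; have /andP[] := fg' x.
apply: ereal_sup_le => _ [h hf <-]; exists h => // x.
by apply: le_trans (hf x) _; have /andP[] := fg' x.
Qed.

Lemma integral_step (R : realType) (mu : probability (measurableTypeR R) R) k
    (c : 'I_k -> R) S : measurable S -> (forall a, (0 <= c a)%R) ->
  \int[mu]_(x in S) (\sum_(a < k) c a * \1_(block k a) x)%:E =
  (\sum_(a < k) c a * fine (mu (S `&` block k a)))%:E.
Proof.
move=> mS c0; under eq_integral do rewrite -sumEFin.
rewrite ge0_integral_sum //; last 2 first.
- move=> a; apply/measurable_EFinP; apply: measurable_funM => //.
  by apply: measurable_indic; exact: measurable_block.
- by move=> a x _; rewrite lee_fin mulr_ge0.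
rewrite -sumEFin; apply: eq_bigr => a _; under eq_integral do rewrite EFinM.
have mI : measurable (S `&` block k a).
  by apply: measurableI => //; exact: measurable_block.
have mB : measurable_fun S (EFin \o (\1_(block k a) : measurableTypeR R -> R)).
  by apply/measurable_EFinP; apply: measurable_indic; exact: measurable_block.
rewrite (ge0_integralZl_EFin _ mS _ mB (c0 a)); last by move=> x _; rewrite lee_fin.
rewrite integral_indic //; last exact: measurable_block.
by rewrite setIC EFinM fineK // fin_num_measure.
Qed.

End integral_blocks.

(** * Bounds on [phi] and [phik] through step measures *)

Section phi_bounds.
Variables (R : realType) (W : R * R -> R) (k : nat) (u : 'I_k -> 'I_k -> R).
Local Notation I := (`[0, 1]%classic : set R).
Hypothesis k0 : (0 < k)%N.
Hypothesis u0 : forall a b, 0 <= u a b.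
Hypothesis K0 : forall x y, I x -> I y -> (0 <= log_kernel W (x, y))%E.
Hypothesis Ku : forall (a b : 'I_k) x y, block k a x -> block k b y ->
  (log_kernel W (x, y) <= (u a b)%:E)%E.

(** For a set [S] in the supremum take [t a = mu (S]&[block k a)]: then [mu S] is the sum of [t],
    and the double integral is at most [quad u t]. Since [S] may meet each block in any proportion,
    the bound is needed on the whole box and not only at its corners. *)
Lemma phi_le (mu : probability (measurableTypeR R) R) (q : 'I_k -> R) (v : R) :
  (forall a : 'I_k, (mu (block k a) <= (q a)%:E)%E) ->
  (forall t, (forall a, 0 <= t a <= q a) -> quad u t <= v * \sum_a t a) ->
  (phi mu W <= v%:E)%E.
Proof.
move=> muq qv; apply: ge_ereal_sup => _ [S [mS SI muS] <-].
pose t (a : 'I_k) := fine (mu (S `&` block k a)).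
have mB a := @measurable_block R k a.
have mSB a : measurable (S `&` block k a : set (measurableTypeR R)) by exact: measurableI.
have tE (a : 'I_k) : mu (S `&` block k a) = (t a)%:E.
  by rewrite fineK // fin_num_measure.
have muSE : mu S = (\sum_a t a)%:E.
  rewrite -{1}(setIidl SI) (measure_blocks _ k0 mS) -sumEFin.
  by apply: eq_bigr => a _; exact: tE.
have tq a : 0 <= t a <= q a.
  rewrite fine_ge0 ?measure_ge0 //= -lee_fin -tE; apply: le_trans (muq a).
  by apply: le_measure; rewrite ?inE //; exact: subIsetr.
(* [F x] is the integral over [y] in [S] of the step kernel [u], with [x] fixed. *)
pose F (x : measurableTypeR R) : R :=
  (\sum_(b < k) (\sum_(a < k) u a b * \1_(block k a) x) * t b)%R.
have inner x : S x ->
    (0 <= \int[mu]_(y in S) log_kernel W (x, y) <= (F x)%:E)%E.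
  move=> Sx; apply/andP; split.
    by apply: integral_ge0 => y Sy; apply: K0; apply: SI.
  rewrite -integral_step //; last first.
    by move=> b; apply: sumr_ge0 => a _; rewrite mulr_ge0.
  apply: ge0_le_integral_pointwise => y Sy; rewrite K0 /=; [|exact: SI..].
  have [a xa] := block_cover k0 (SI _ Sx); have [b yb] := block_cover k0 (SI _ Sy).
  apply: le_trans (Ku xa yb) _; rewrite lee_fin.
  rewrite (bigD1 b) //= (bigD1 a) //= !indicE !mem_set // !mulr1.
  rewrite -addrA lerDl addr_ge0 //.
    by apply: sumr_ge0 => a' _; rewrite mulr_ge0.
  apply: sumr_ge0 => b' _; rewrite mulr_ge0 //.
  by apply: sumr_ge0 => a' _; rewrite mulr_ge0.
have outer : (\int[mu]_(x in S) \int[mu]_(y in S) log_kernel W (x, y) <=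
    (quad u t)%:E)%E.
  apply: le_trans (ge0_le_integral_pointwise mu inner) _.
  have -> : F = fun x : measurableTypeR R =>
      \sum_(a < k) (\sum_(b < k) u a b * t b) * \1_(block k a) x.
    apply/funext => x; rewrite /F.
    under eq_bigr do rewrite mulr_suml.
    rewrite exchange_big /=; apply: eq_bigr => a _; rewrite mulr_suml.
    by apply: eq_bigr => b _; rewrite mulrAC.
  rewrite integral_step //; last first.
    move=> a; apply: sumr_ge0 => b _; rewrite mulr_ge0 //.
    by have /andP[] := tq b.
  rewrite lee_fin /quad; under eq_bigr do rewrite mulr_suml.
  apply: ler_sum => a _; apply: ler_sum => b _.
  by rewrite -/(t a) mulrC mulrA mulrAC.
rewrite muSE in muS *; rewrite lte_fin in muS.
rewrite inver gt_eqF // -lee_pdivlMl ?invr_gt0 // invrK -EFinM [X in (_ <= X%:E)%E]mulrC.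
by apply: le_trans outer _; rewrite lee_fin qv.
Qed.

End phi_bounds.

Section step_probability.
Variables (R : realType) (k : nat) (q : 'I_k -> R).
Hypothesis k0 : (0 < k)%N.
Hypothesis q0 : forall a, 0 <= q a.
Hypothesis q1 : \sum_a q a = 1.

(** The measure with density [k * q a] on block [a], which gives that block mass [q a]. *)
Lemma step_probability : exists mu : probability (measurableTypeR R) R,
  forall A, mu A = (\sum_a (k%:R * q a)%:E * lambda01 R (A `&` block k a))%E.
Proof.
(* [msum] takes a sequence indexed by [nat], hence the value 0 beyond the [k] blocks. *)
pose c (a : nat) : {nonneg R} :=
  if insub a is Some a' then NngNum (mulr_ge0 (ler0n R k) (q0 a')) else NngNum (lexx (0 : R)).
have cE (a : 'I_k) : (c a)%:num = k%:R * q a by rewrite /c valK.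
pose m (a : nat) : {measure set (measurableTypeR R) -> \bar R} :=
  mscale (c a) (mrestr (lambda01 R) (@measurable_block R k a)).
pose nu := msum m k.
have nuE A : nu A = (\sum_a (k%:R * q a)%:E * lambda01 R (A `&` block k a))%E.
  by rewrite /nu /msum; apply: eq_bigr => a _; rewrite /m /= /mscale /= cE.
have nuT : nu setT = 1%E.
  rewrite nuE; transitivity ((\sum_a q a)%:E); last by rewrite q1.
  rewrite -sumEFin; apply: eq_bigr => a _.
  rewrite setTI (_ : lambda01 R _ = (k%:R^-1)%:E); last exact: lambda01_block.
  by rewrite -EFinM mulrAC divff ?mul1r // pnatr_eq0 -lt0n.
pose P := Measure_isProbability.Build _ _ _ nu nuT.
by exists (HB.pack_for (probability (measurableTypeR R) R) nu P).
Qed.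

End step_probability.

(** Different indices may give the same measure, while [C_lambda] attaches one weight to each
    measure: the weights on a fibre of [m] are merged. *)
Lemma sum_fiber (J : finType) (T : choiceType) (R : realType) (M : {fset T})
    (m : J -> T) (al : J -> R) (F : T -> \bar R) :
  (forall j, 0 <= al j) -> (forall j, al j != 0 -> m j \in M) ->
  (\sum_(t <- M) (\sum_(j | m j == t) al j)%:E * F t =
   \sum_j (al j)%:E * F (m j))%E.
Proof.
move=> al0 mM.
transitivity (\sum_(t <- M) \sum_(j | m j == t) (al j)%:E * F (m j))%E.
  apply: eq_bigr => t _; rewrite -sumEFin ge0_sume_distrl => [|j _]; last by rewrite lee_fin.
  by apply: eq_bigr => j /eqP->.
rewrite (exchange_big_dep predT) //=; apply: eq_bigr => j _.
have [al_j|al_j] := eqVneq (al j) 0.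
  by rewrite al_j big1 ?mul0e // => t _; rewrite mul0e.
rewrite (big_rem (m j)) ?mM //= eqxx big_seq_cond big1 ?adde0 // => t /andP[+ /eqP tj].
by rewrite tj mem_rem_uniq ?fset_uniq // inE eqxx.
Qed.

Section phik_bound.
Variables (R : realType) (W : R * R -> R) (k : nat) (u : 'I_k -> 'I_k -> R).
Local Notation I := (`[0, 1]%classic : set R).
Hypothesis k0 : (0 < k)%N.
Hypothesis u0 : forall a b, 0 <= u a b.
Hypothesis K0 : forall x y, I x -> I y -> (0 <= log_kernel W (x, y))%E.
Hypothesis Ku : forall (a b : 'I_k) x y, block k a x -> block k b y ->
  (log_kernel W (x, y) <= (u a b)%:E)%E.

(** The step measures with profiles [q j] and weights [al j] are admissible in [phik]: their mixture
    gives mass [1 / k] to each block, with constant density, so it is the uniform measure. *)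
Lemma phik_le (J : finType) (al v : J -> R) (q : J -> 'I_k -> R) :
  (forall j, 0 <= al j) -> (#|[set j | al j != 0%R]%SET| <= k)%N ->
  (forall a, \sum_j al j * q j a = k%:R^-1) ->
  (forall j, al j != 0 -> [/\ forall a, 0 <= q j a, \sum_a q j a = 1 &
    forall t, (forall a, 0 <= t a <= q j a) -> quad u t <= v j * \sum_a t a]) ->
  (phik k W <= (\sum_j al j * v j)%:E)%E.
Proof.
move=> al0 alk alq qP.
have kR : k%:R != 0 :> R by rewrite pnatr_eq0 -lt0n.
(* Where [al j = 0], [q j] need not be a probability vector; [lambda01] is a dummy value there. *)
have /choice[m mE] j : exists mu : probability (measurableTypeR R) R,
    al j != 0 -> forall A, mu A =
      (\sum_a (k%:R * q j a)%:E * lambda01 R (A `&` block k a))%E.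
  have [alj|alj] := eqVneq (al j) 0; first by exists (lambda01 R).
  by have [h1 h2 _] := qP j alj; have [mu muE] := step_probability k0 h1 h2; exists mu.
pose M := [fset x in [seq m j | j <- enum [set j | al j != 0%R]%SET]]%fset.
pose a mu := \sum_(j | m j == mu) al j.
have mM j : al j != 0 -> m j \in M.
  by move=> alj; rewrite inE; apply: map_f; rewrite mem_enum inE.
have sum_al : \sum_j al j = 1.
  transitivity (\sum_j \sum_a al j * q j a).
    apply: eq_bigr => j _; rewrite -mulr_sumr.
    have [->|alj] := eqVneq (al j) 0; first by rewrite mul0r.
    by have [_ -> _] := qP j alj; rewrite mulr1.
  rewrite exchange_big /=; under eq_bigr do rewrite alq.
  by rewrite sumr_const card_ord -[RHS](divff kR) mulr_natl.
have a0 mu : 0 <= a mu by exact: sumr_ge0.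
have a1 : \sum_(mu <- M) a mu = 1.
  apply: EFin_inj; rewrite -sum_al -!sumEFin.
  have := sum_fiber (fun=> 1%E) al0 mM.
  by under eq_bigr do rewrite mule1; under [RHS]eq_bigr do rewrite mule1.
apply: (@le_trans _ _ (\sum_(mu <- M) (a mu)%:E * phi mu W)%E).
  apply: ereal_inf_lbound; exists M, a; split => //; last first.
    by rewrite card_fseq (leq_trans (size_undup _)) // size_map -cardE.
  split=> [mu|mu muM||A mA] //.
  - rewrite inE => /mapP[j]; rewrite mem_enum inE => alj ->.
    have [_ qj1 _] := qP j alj.
    rewrite mE //; transitivity ((\sum_a q j a)%:E); last by rewrite qj1.
    rewrite -sumEFin; apply: eq_bigr => b _.
    rewrite (_ : lambda01 R _ = (k%:R^-1)%:E); last first.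
      rewrite -(lambda01_block R b); congr (lambda01 R _); apply/setIidr => x.
      exact: block_I.
    by rewrite -EFinM mulrAC divff ?mul1r.
  - rewrite a0 /= -a1 (big_rem mu) //= lerDl; exact: sumr_ge0.
  - rewrite (sum_fiber (fun mu : probability (measurableTypeR R) R => mu A) al0 mM).
    transitivity (\sum_j \sum_b (al j * q j b)%:E *
        (k%:R%:E * lambda01 R (A `&` block k b)))%E.
      apply: eq_bigr => j _; have [alj|alj] := eqVneq (al j) 0.
        by rewrite alj mul0e big1 // => b _; rewrite mul0r mul0e.
      rewrite mE // ge0_sume_distrr => [|b _]; last first.
        by rewrite mule_ge0 // lee_fin mulr_ge0 //; have [] := qP j alj.
      apply: eq_bigr => b _; rewrite !muleA -!EFinM; congr (_%:E * _)%E; ring.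
    rewrite exchange_big /= -lambda01_setI (measure_blocks _ k0 mA).
    apply: eq_bigr => b _; rewrite -ge0_sume_distrl => [|j _]; last first.
      have [->|alj] := eqVneq (al j) 0; first by rewrite mul0r.
      by rewrite lee_fin mulr_ge0 //; have [] := qP j alj.
    by rewrite sumEFin alq muleA -EFinM mulVf // mul1e.
rewrite (sum_fiber (fun mu => phi mu W) al0 mM) -sumEFin; apply: lee_sum => j _.
have [->|alj] := eqVneq (al j) 0; first by rewrite mul0e mul0r.
rewrite EFinM lee_pmul2l //; last by rewrite lte_fin lt_neqAle eq_sym alj al0.
have [q0 q1 qv] := qP j alj; apply: (phi_le k0 u0 K0 Ku _ qv) => b.
rewrite mE // (bigD1 b) //= setIid big1 ?adde0 => [|b' bb'].
  rewrite (_ : lambda01 R _ = (k%:R^-1)%:E); last exact: lambda01_block.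
  by rewrite -EFinM mulrAC divff ?mul1r.
have /trivIsetP/(_ b b' Logic.I Logic.I) := @trivIset_block R k.
by rewrite eq_sym bb' => ->//; rewrite measure0 mule0.
Qed.

End phik_bound.

(** * Shifting the profiles by one block *)

Section shifted_bound.
Variables (R : realType) (W : R * R -> R) (k : nat) (w : 'I_k -> 'I_k -> R).
Variables (B : {set 'I_k}) (e L : R).
Local Notation I := (`[0, 1]%classic : set R).
Hypothesis k0 : (0 < k)%N.
Hypothesis w0 : forall a b, 0 <= w a b.
Hypotheses (e0 : 0 <= e) (L0 : 0 <= L).
Hypothesis K0 : forall x y, I x -> I y -> (0 <= log_kernel W (x, y))%E.
Hypothesis KL : forall x y, I x -> I y -> (log_kernel W (x, y) <= L%:E)%E.
Hypothesis Kw : forall (a b : 'I_k) x y, a \notin B -> b \notin B ->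
  block k a x -> block k b y ->
  (log_kernel W (x, y) <= (w (ordS a) (ordS b) + e)%:E)%E.

(** A step kernel above [K]: the shifted [w] with error [e], and the trivial bound [L] as soon as
    one index is exceptional. The successor [ordS] is cyclic, so that the shift permutes the
    blocks. *)
Let shift_kernel (a b : 'I_k) : R :=
  w (ordS a) (ordS b) + e + L * ((a \in B)%:R + (b \in B)%:R).

Let shift_kernel_ge0 a b : 0 <= shift_kernel a b.
Proof. by rewrite /shift_kernel !addr_ge0 // mulr_ge0 // addr_ge0. Qed.

Let log_kernel_shift (a b : 'I_k) x y : block k a x -> block k b y ->
  (log_kernel W (x, y) <= (shift_kernel a b)%:E)%E.
Proof.
move=> xa yb; have Ix := block_I (ltn_ord a) xa; have Iy := block_I (ltn_ord b) yb.
have [aB|aB] := boolP (a \in B).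
  apply: le_trans (KL Ix Iy) _; rewrite lee_fin /shift_kernel aB mulrDr mulr1.
  by rewrite addrCA lerDl addr_ge0 ?mulr_ge0 // addr_ge0.
have [bB|bB] := boolP (b \in B).
  apply: le_trans (KL Ix Iy) _; rewrite lee_fin /shift_kernel (negbTE aB) bB.
  by rewrite add0r mulr1 lerDr addr_ge0.
by rewrite /shift_kernel (negbTE aB) (negbTE bB) addr0 mulr0 addr0; exact: Kw.
Qed.

(** The profile [q] is [s] normalised and moved one block to the left. Its total is 1, so [T <= 1],
    and the error terms [e * T * T] and [2 * L * TB * T] are at most linear in [T]. *)
Let quad_shift_kernel (V : R) (s t : 'I_k -> R) :
  (forall a, 0 <= s a) -> \sum_a s a != 0 ->
  (forall t, (forall a, 0 <= t a <= s a) -> quad w t <= V * \sum_a t a) ->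
  let q a := s (ordS a) / \sum_a s a in
  (forall a, 0 <= t a <= q a) ->
  quad shift_kernel t <=
    (V / (\sum_a s a) + e + 2 * L * \sum_(a in B) q a) * \sum_a t a.
Proof.
move=> s0 z0 sV q tq; set z := \sum_a s a in z0 q tq *.
have zp : 0 < z by rewrite lt_neqAle eq_sym z0 sumr_ge0.
have t0 a : 0 <= t a by have /andP[] := tq a.
set T := \sum_a t a; have T0 : 0 <= T by exact: sumr_ge0.
have q1 : \sum_a q a = 1.
  rewrite /q -mulr_suml -(reindex_inj (h := @ordS k) (F := s) (P := xpredT)) //=.
    by rewrite divff.
  exact: ordS_inj.
have T1 : T <= 1 by rewrite -q1; apply: ler_sum => a _; have /andP[] := tq a.
set TB := \sum_(a in B) t a.
have TBq : TB <= \sum_(a in B) q a.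
  by apply: ler_sum => a _; have /andP[] := tq a.
have TBE : TB = \sum_a t a * (a \in B)%:R.
  rewrite /TB big_mkcond /=; apply: eq_bigr => a _.
  by case: (a \in B); rewrite ?mulr1 ?mulr0.
have -> : quad shift_kernel t =
    quad (fun a b => w (ordS a) (ordS b)) t + e * T * T + 2 * L * TB * T.
  have TT : T * T = \sum_a \sum_b t a * t b.
    by rewrite /T mulr_suml; apply: eq_bigr => a _; rewrite mulr_sumr.
  have TBT : TB * T = \sum_a \sum_b t a * t b * (a \in B)%:R.
    rewrite TBE mulr_suml; apply: eq_bigr => a _; rewrite mulr_sumr.
    by apply: eq_bigr => b _; rewrite mulrAC.
  have TBT' : TB * T = \sum_a \sum_b t a * t b * (b \in B)%:R.
    rewrite mulrC TBE mulr_suml; apply: eq_bigr => a _; rewrite mulr_sumr.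
    by apply: eq_bigr => b _; rewrite mulrA.
  rewrite (_ : 2 * L * TB * T = L * (TB * T) + L * (TB * T)); last by ring.
  rewrite {1}TBT TBT' -!mulrA TT /quad !mulr_sumr -!big_split /=.
  apply: eq_bigr => a _; rewrite !mulr_sumr -!big_split /=.
  by apply: eq_bigr => b _; rewrite /shift_kernel; ring.
rewrite [X in _ <= X]mulrDl [X in _ <= X + _]mulrDl; apply: lerD; first (apply: lerD).
(* Undoing the shift and the normalisation brings [t] back into the box of [s]. *)
- pose t' c := z * t (ord_pred c).
  have := sV t'; have t's a : 0 <= t' a <= s a.
    have /andP[_] := tq (ord_pred a); rewrite /t' /q ord_predK ler_pdivlMr // mulrC => ->.
    by rewrite mulr_ge0 // ltW.
  move=> /(_ t's); have -> : \sum_a t' a = z * T.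
    rewrite /t' -mulr_sumr (reindex_inj (@ordS_inj k)) /=.
    by congr (_ * _); apply: eq_bigr => a _; rewrite ordSK.
  have -> : quad w t' = z * (z * quad (fun a b => w (ordS a) (ordS b)) t).
    rewrite /quad (reindex_inj (@ordS_inj k)) /= !mulr_sumr; apply: eq_bigr => a _.
    rewrite (reindex_inj (@ordS_inj k)) /= !mulr_sumr; apply: eq_bigr => b _.
    by rewrite /t' !ordSK; ring.
  by rewrite [V * _]mulrCA ler_pM2l // mulrAC ler_pdivlMr // mulrC.
- by rewrite -[X in _ <= X]mulr1 ler_wpM2l // mulr_ge0.
- by rewrite ler_wpM2r // ler_wpM2l // mulr_ge0.
Qed.

(** Class [j], of size [z j], gets the weight [z j / (k * N)], which makes the mixture of the
    normalised profiles uniform. Its main term [V / z j] then contributes at most [V / (k * N)],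
    whatever its size. *)
Lemma phik_le_shift (J : finType) (s : J -> 'I_k -> R) (N V : R) :
  0 < N -> 0 <= V -> (forall j a, 0 <= s j a) ->
  (forall a, \sum_j s j a = N) ->
  (forall j t, (forall a, 0 <= t a <= s j a) -> quad w t <= V * \sum_a t a) ->
  (phik k W <= (#|J|%:R * V / (k%:R * N) + e + 2 * L * #|B|%:R / k%:R)%:E)%E.
Proof.
move=> N0 V0 s0 sN sV.
have kR : 0 < k%:R :> R by rewrite ltr0n.
have kR0 : k%:R != 0 :> R by rewrite gt_eqF.
pose z j := \sum_a s j a.
have z0 j : 0 <= z j by exact: sumr_ge0.
have zs j a : z j = 0 -> s j a = 0.
  move=> /eqP; rewrite psumr_eq0 // => /allP/(_ a).
  by rewrite mem_index_enum => /(_ isT)/eqP.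
pose al j := z j / (k%:R * N).
pose P j a := s j a / z j.
have al0 j : 0 <= al j by rewrite divr_ge0 // mulr_ge0 // ltW.
have alz j : al j != 0 -> z j != 0 by apply: contra => /eqP zj; rewrite /al zj mul0r.
have alP a : \sum_j al j * P j a = k%:R^-1.
  transitivity (\sum_j s j a / (k%:R * N)).
    apply: eq_bigr => j _; rewrite /al /P; have [zj|zj] := eqVneq (z j) 0.
      by rewrite zj zs // !mul0r.
    by field; rewrite zj kR0 gt_eqF.
  by rewrite -mulr_suml sN; field; rewrite kR0 gt_eqF.
have P1 j : al j != 0 -> \sum_a P j a = 1.
  by move=> /alz zj; rewrite /P -mulr_suml divff.
(* Only the main term enters the reduction. The error terms depend on the mixture alone, which is
   preserved. *)
have [be [be0 beal beP bev bek]] := caratheodory (fun j => V / z j) al0 P1.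
have bez j : be j != 0 -> z j != 0.
  by move=> bej; apply: alz; apply: contra bej => /eqP/beal->.
pose q j a := P j (ordS a).
have sum_q j : z j != 0 -> \sum_a q j a = 1.
  move=> zj; rewrite /q /P -mulr_suml.
  rewrite -(reindex_inj (h := @ordS k) (F := s j) (P := xpredT)) //=; last exact: ordS_inj.
  by rewrite divff.
have beq a : \sum_j be j * q j a = k%:R^-1 by rewrite beP alP.
have sum_be : \sum_j be j = 1.
  transitivity (\sum_j \sum_a be j * q j a).
    apply: eq_bigr => j _; rewrite -mulr_sumr.
    have [->|bej] := eqVneq (be j) 0; first by rewrite mul0r.
    by rewrite sum_q ?mulr1 // bez.
  rewrite exchange_big /=; under eq_bigr do rewrite beq.
  by rewrite sumr_const card_ord -[RHS](divff kR0) mulr_natl.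
pose v j := V / z j + e + 2 * L * \sum_(a in B) q j a.
apply: le_trans (phik_le k0 shift_kernel_ge0 K0 log_kernel_shift (v := v) be0 bek beq _) _.
  move=> j bej; have zj := bez j bej; split; last 1 first.
    by move=> t tq; exact: (quad_shift_kernel (s0 j) zj (sV j) tq).
  - by move=> a; rewrite divr_ge0.
  - exact: sum_q.
rewrite lee_fin /v.
under eq_bigr do rewrite !mulrDr.
rewrite !big_split /= -mulr_suml sum_be mul1r.
have -> : \sum_j be j * (2 * L * \sum_(a in B) q j a) = 2 * L * #|B|%:R / k%:R.
  transitivity (2 * L * \sum_(a in B) \sum_j be j * q j a).
    rewrite exchange_big /= mulr_sumr; apply: eq_bigr => j _.
    by rewrite mulrCA -mulr_sumr.
  by under eq_bigr do rewrite beq; rewrite sumr_const -!mulrA [#|B|%:R * _]mulr_natl.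
rewrite !lerD2r; apply: le_trans bev _.
have -> : #|J|%:R * V / (k%:R * N) = \sum_(j : J) V / (k%:R * N).
  by rewrite sumr_const -mulrA mulr_natl.
apply: ler_sum => j _; rewrite /al; have [zj|zj] := eqVneq (z j) 0.
  by rewrite zj !mul0r divr_ge0 // mulr_ge0 // ltW.
rewrite le_eqVlt; apply/orP; left; apply/eqP.
by field; rewrite zj kR0 gt_eqF.
Qed.

End shifted_bound.

(** * Comparison of the kernel on neighbouring blocks *)

Section oscillation.
Variables (R : realType) (W : R * R -> R).
Local Notation I := (`[0, 1]%classic : set R).

(** The last block counts as straddling, because the cyclic successor sends it to the first
    block. *)
Definition straddles (F : set (set R)) k (a : nat) : Prop :=
  ~ ((a.+1 < k)%N /\ exists S, [/\ F S, block k a `<=` S & block k a.+1 `<=` S]).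

(* Two indices of equal parity whose left end points lie in the same interval of
   the partition cannot both straddle. *)
Lemma card_straddles (F : set (set R)) : interval_partition F ->
  exists C : nat, forall k, (0 < k)%N -> exists B : {set 'I_k},
    (#|B| <= C)%N /\ forall a, a \notin B -> ~ straddles F k a.
Proof.
case=> finF [FI _ _] itvF; pose X := fset_set F.
exists #|{: option (X * bool)}| => k k0.
pose B := [set a : 'I_k | `[< straddles F k a >]]%SET.
exists B; split; last by move=> a; rewrite inE => /asboolP.
have /choice[S SE] (a : 'I_k) : exists S : X, fsval S (a%:R / k%:R).
  have := block_I (ltn_ord a) (block_left R (ltn_ord a)).
  rewrite -FI => -[S FS Sa].
  have SX : S \in X by rewrite in_fset_set // inE.
  by exists [` SX]%fset.
have FS a : F (fsval (S a)).
  by have := fsvalP (S a); rewrite in_fset_set // inE.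
(* [None] is reserved for the last block. If [g a = g b] and [a < b], parity gives [a + 2 <= b], so
   blocks [a] and [a + 1] lie between two points of the interval [S a]. *)
pose g (a : 'I_k) := if (a.+1 < k)%N then Some (S a, odd a) else None.
apply: (leq_card_in g); suff gE (a b : 'I_k) : a \in B -> g a = g b -> ~ (a < b)%N.
  move=> a b aB bB gab; apply/val_inj; case: (ltngtP a b) => // lt_ab.
    by have := gE a b aB gab lt_ab.
  by have := gE b a bB (esym gab) lt_ab.
rewrite inE /g => /asboolP aB + lt_ab.
have ak : (a.+1 < k)%N by apply: leq_ltn_trans (ltn_ord b).
rewrite ak; case: ifP => // bk [Sab odd_ab].
have ab2 : (a.+2 <= b)%N.
  rewrite ltn_neqAle lt_ab andbT; apply/eqP => ab.
  by move: odd_ab; rewrite -ab /=; case: (odd a).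
have akk : (a.+2 < k)%N by lia.
apply: aB; split => //; exists (fsval (S a)); split; first exact: FS.
- move=> x /(blockE _ ak)/andP[xa ax].
  apply: (itvF _ (FS a) _ _ (SE a)); first by rewrite Sab; exact: SE.
  rewrite xa (le_trans (ltW ax)) // ler_pM2r ?invr_gt0 ?ltr0n // ler_nat; lia.
- move=> x /(blockE _ akk)/andP[xa ax].
  apply: (itvF _ (FS a) _ _ (SE a)); first by rewrite Sab; exact: SE.
  rewrite (le_trans _ xa) ?(le_trans (ltW ax)) //
    ler_pM2r ?invr_gt0 ?ltr0n // ler_nat; lia.
Qed.

Lemma block_ordS k (a : 'I_k) (x x' : R) : (a.+1 < k)%N ->
  block k a x -> block k (ordS a) x' ->
  [/\ block k a.+1 x', x <= x' & x' <= x + 2 / k%:R].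
Proof.
move=> ak xa; rewrite /= modn_small // => xa'; split => //.
  exact: ltW (block_lt (ltnSn a) ak xa xa').
have /andP[_ h2] := block_bounds ak xa'; have /andP[h1 _] := block_bounds (ltn_ord a) xa.
apply: le_trans h2 _; rewrite -[a.+2]addn2 natrD mulrDl lerD2r //.
Qed.

(** Both coordinates move to the right within one interval of the partition, so [W] does not
    decrease. The slack [C / k] gives the conclusion the form it has in the Lipschitz case. *)
Lemma block_increasing_osc : block_increasing W ->
  exists C : R, 0 <= C /\ forall k, (0 < k)%N -> exists B : {set 'I_k},
    #|B|%:R <= C /\ forall (a b : 'I_k) x y x' y', a \notin B -> b \notin B ->
      block k a x -> block k b y -> block k (ordS a) x' -> block k (ordS b) y' ->
      W (x, y) <= W (x', y') + C / k%:R.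
Proof.
case=> F Fp Finc; have [C CP] := card_straddles Fp.
exists C%:R; split => // k k0; have [B [BC BP]] := CP k k0.
exists B; split; first by rewrite ler_nat.
move=> a b x y x' y' /BP/contrapT[ak [S [FS aS aS']]] /BP/contrapT[bk [S' [FS' bS bS']]].
move=> xa yb xa' yb'.
have [xa1 xx' _] := block_ordS ak xa xa'; have [yb1 yy' _] := block_ordS bk yb yb'.
have [inc1 inc2] := Finc _ _ FS FS'.
rewrite -[X in X <= _]addr0 lerD ?divr_ge0 //.
apply: (le_trans (inc1 x x' y _ _ _ xx')); [exact: aS|exact: aS'|exact: bS|].
by apply: inc2 => //; [exact: aS'|exact: bS|exact: bS'].
Qed.

(** Points of two consecutive blocks are at distance at most [2 / k]. *)
Lemma block_lipschitz_osc : block_lipschitz W ->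
  exists C : R, 0 <= C /\ forall k, (0 < k)%N -> exists B : {set 'I_k},
    #|B|%:R <= C /\ forall (a b : 'I_k) x y x' y', a \notin B -> b \notin B ->
      block k a x -> block k b y -> block k (ordS a) x' -> block k (ordS b) y' ->
      W (x, y) <= W (x', y') + C / k%:R.
Proof.
case=> F Fp Flip; have [C CP] := card_straddles Fp.
have [M [M0 MP]] : exists M : R, 0 <= M /\ forall S S', F S -> F S' ->
    forall x y x' y', S x -> S' y -> S x' -> S' y' ->
    `|W (x, y) - W (x', y')| <= M * Num.max `|x - x'| `|y - y'|.
  have [finF _ _] := Fp; pose X := fset_set F.
  have FX (S : X) : F (fsval S) by have := fsvalP S; rewrite in_fset_set // inE.
  have /choice[m mP] (p : X * X) : exists m : R, forall M, m < M ->
      forall x y x' y', fsval p.1 x -> fsval p.2 y -> fsval p.1 x' -> fsval p.2 y' ->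
      `|W (x, y) - W (x', y')| <= M * Num.max `|x - x'| `|y - y'|.
    have [m [_ mM]] := Flip _ _ (FX p.1) (FX p.2).
    exists m => M /mM mM' x y x' y' xS yS xS' yS'.
    exact: (mM' ((x, y), (x', y'))).
  (* One Lipschitz constant for all pairs of intervals. The added 1 makes it strictly larger than
     each threshold [m p]. *)
  exists (\sum_p (`|m p| + 1)); split; first by apply: sumr_ge0 => p _; rewrite addr_ge0.
  move=> S S' FS FS' x y x' y' xS yS xS' yS'.
  have XS : S \in X by rewrite in_fset_set // inE.
  have XS' : S' \in X by rewrite in_fset_set // inE.
  apply: (mP ([` XS]%fset, [` XS']%fset)) => //.
  rewrite (bigD1 ([` XS]%fset, [` XS']%fset)) //=.
  apply: (@lt_le_trans _ _ (`|m ([` XS]%fset, [` XS']%fset)| + 1)).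
    by rewrite (le_lt_trans (ler_norm _)) // ltrDl.
  by rewrite lerDl; apply: sumr_ge0 => p _; rewrite addr_ge0.
exists (C%:R + M * 2); split; first by rewrite addr_ge0 // mulr_ge0.
move=> k k0; have [B [BC BP]] := CP k k0.
exists B; split.
  by rewrite -[X in X <= _]addr0 lerD ?mulr_ge0 // ler_nat.
move=> a b x y x' y' /BP/contrapT[ak [S [FS aS aS']]] /BP/contrapT[bk [S' [FS' bS bS']]].
move=> xa yb xa' yb'.
have [xa1 xx' xx2] := block_ordS ak xa xa'; have [yb1 yy' yy2] := block_ordS bk yb yb'.
rewrite -lerBlDl (le_trans (ler_norm _)) //.
apply: (le_trans (MP _ _ FS FS' _ _ _ _ (aS _ xa) (bS _ yb) (aS' _ xa1) (bS' _ yb1))).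
apply: (@le_trans _ _ (M * (2 / k%:R))).
  rewrite ler_wpM2l // ge_max !ler_norml; apply/andP; split; apply/andP; split; lra.
by rewrite mulrA ler_wpM2r // lerDr.
Qed.

End oscillation.

(** * The real-valued kernel, its block infima and colour classes *)

Section log_kernel.
Variables (R : realType) (W : R * R -> R) (s : R).
Local Notation I := (`[0, 1]%classic : set R).
Hypothesis W01 : forall x y, I x -> I y -> 0 <= W (x, y) <= s.
Hypothesis s1 : s < 1.

Definition rlog_kernel (z : R * R) : R := - ln (1 - W z).

Local Notation K := rlog_kernel.
Local Notation L := (- ln (1 - s)).

Lemma one_sub_W_gt0 x y : I x -> I y -> 0 < 1 - W (x, y).
Proof. by move=> Ix Iy; have /andP[_ Ws] := W01 Ix Iy; rewrite subr_gt0 (le_lt_trans Ws). Qed.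

Lemma log_kernelE x y : I x -> I y -> log_kernel W (x, y) = (K (x, y))%:E.
Proof.
move=> Ix Iy; have W1 := one_sub_W_gt0 Ix Iy.
by rewrite /log_kernel inver gt_eqF // lne_EFin ?invr_gt0 // lnV.
Qed.

Lemma rlog_kernel_ge0 x y : I x -> I y -> 0 <= K (x, y).
Proof.
move=> Ix Iy; have /andP[W0 _] := W01 Ix Iy.
by rewrite oppr_ge0 ln_le0 // gerBl.
Qed.

Lemma rlog_kernel_le x y : I x -> I y -> K (x, y) <= L.
Proof.
move=> Ix Iy; have /andP[_ Ws] := W01 Ix Iy.
by rewrite lerN2 ler_ln ?posrE ?subr_gt0 // ?lerD2l ?lerN2 // (le_lt_trans Ws).
Qed.

Lemma log_kernel_bound_ge0 : 0 <= L.
Proof.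
have I0 : I 0 by rewrite /= in_itv /= lexx ler01.
exact: le_trans (rlog_kernel_ge0 I0 I0) (rlog_kernel_le I0 I0).
Qed.

(** The difference of the two values of [K] is the logarithm of a ratio [1 + u], bounded by [u],
    whose denominator [1 - W] is at least [1 - s]. *)
Lemma rlog_kernel_lipschitz x y x' y' d : I x -> I y -> I x' -> I y' -> 0 <= d ->
  W (x, y) <= W (x', y') + d -> K (x, y) <= K (x', y') + d / (1 - s).
Proof.
move=> Ix Iy Ix' Iy' d0 Wd.
have p := one_sub_W_gt0 Ix Iy; have p' := one_sub_W_gt0 Ix' Iy'.
have /andP[_ Ws] := W01 Ix Iy.
rewrite -lerBlDl /K opprK addrC -ln_div ?posrE //.
set r := (1 - W (x', y')) / (1 - W (x, y)).
have -> : r = 1 + (W (x, y) - W (x', y')) / (1 - W (x, y)).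
  by rewrite /r; field; rewrite gt_eqF.
apply: le_trans (le_ln1Dx _) _.
  rewrite -(ltrD2l 1) subrr.
  have -> : 1 + (W (x, y) - W (x', y')) / (1 - W (x, y)) = r.
    by rewrite /r; field; rewrite gt_eqF.
  by rewrite divr_gt0.
apply: (@le_trans _ _ (d / (1 - W (x, y)))).
  by rewrite ler_pM2r ?invr_gt0 // lerBlDl.
by rewrite ler_wpM2l // lef_pV2 ?posrE // ?subr_gt0 // lerD2l lerN2.
Qed.

Definition block_inf k (a b : 'I_k) : R :=
  inf [set K z | z in block k a `*` block k b].

Lemma block_inf_le k (a b : 'I_k) x y :
  block k a x -> block k b y -> block_inf a b <= K (x, y).
Proof.
move=> xa yb; apply: ge_inf; last by exists (x, y).
exists 0 => _ [[x' y'] [/= xa' yb'] <-].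
by apply: rlog_kernel_ge0; [exact: (block_I (ltn_ord a))|exact: (block_I (ltn_ord b))].
Qed.

Lemma le_block_inf k (a b : 'I_k) c :
  (forall x y, block k a x -> block k b y -> c <= K (x, y)) -> c <= block_inf a b.
Proof.
move=> cK; apply: lb_le_inf; last by move=> _ [[x y] [/= xa yb] <-]; exact: cK.
exists (K (a%:R / k%:R, b%:R / k%:R)); exists (a%:R / k%:R, b%:R / k%:R) => //.
by split; exact: block_left.
Qed.

Lemma block_inf_ge0 k (a b : 'I_k) : 0 <= block_inf a b.
Proof.
apply: le_block_inf => x y xa yb.
by apply: rlog_kernel_ge0; [exact: (block_I (ltn_ord a))|exact: (block_I (ltn_ord b))].
Qed.

(* [p j] is the profile over the blocks of the [j]-th class of a fractional
   colouring that uses every block with the same total weight [N]. *)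
Definition cover_bound k (c : R) : Prop :=
  forall (J : finType) (p : J -> 'I_k -> R) (N V : R),
    0 < N -> 0 <= V -> (forall j a, 0 <= p j a) -> (forall a, \sum_j p j a = N) ->
    (forall j t, (forall a, 0 <= t a <= p j a) ->
       quad (@block_inf k) t <= V * \sum_a t a) ->
    (phik k W <= (#|J|%:R * V / (k%:R * N) + c / k%:R)%:E)%E.

Lemma phik_le_weights : block_increasing W \/ block_lipschitz W ->
  exists c : R, 0 <= c /\ forall k, (0 < k)%N -> cover_bound k c.
Proof.
move=> Wreg.
have [C [C0 CP]] : exists C : R, 0 <= C /\ forall k, (0 < k)%N -> exists B : {set 'I_k},
    #|B|%:R <= C /\ forall (a b : 'I_k) x y x' y', a \notin B -> b \notin B ->
      block k a x -> block k b y -> block k (ordS a) x' -> block k (ordS b) y' ->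
      W (x, y) <= W (x', y') + C / k%:R.
  by case: Wreg; [exact: block_increasing_osc|exact: block_lipschitz_osc].
have s1' : 0 < 1 - s by rewrite subr_gt0.
(* The first term is the oscillation of [W] converted to [K]; the second pays for the at most [C]
   exceptional blocks, where only [K <= L] is available. *)
exists (C / (1 - s) + 2 * L * C); split.
  by rewrite addr_ge0 ?mulr_ge0 ?invr_ge0 ?log_kernel_bound_ge0 // ltW.
move=> k k0 J p N V N0 V0 p0 pN pV; have [B [BC BP]] := CP k k0.
have kR : 0 < k%:R :> R by rewrite ltr0n.
have e0 : 0 <= C / k%:R / (1 - s) by rewrite !divr_ge0 // ltW.
apply: le_trans (phik_le_shift k0 (@block_inf_ge0 k) e0 log_kernel_bound_ge0
  _ _ _ (B := B) N0 V0 p0 pN pV) _.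
- by move=> x y Ix Iy; rewrite log_kernelE // lee_fin rlog_kernel_ge0.
- by move=> x y Ix Iy; rewrite log_kernelE // lee_fin rlog_kernel_le.
- move=> a b x y aB bB xa yb.
  have Ix := block_I (ltn_ord a) xa; have Iy := block_I (ltn_ord b) yb.
  rewrite log_kernelE // lee_fin -lerBlDr; apply: le_block_inf => x' y' xa' yb'.
  rewrite lerBlDr; apply: rlog_kernel_lipschitz => //.
  + exact: block_I (ltn_ord (ordS a)) xa'.
  + exact: block_I (ltn_ord (ordS b)) yb'.
  + by rewrite divr_ge0.
  + exact: (BP a b).
rewrite lee_fin -addrA lerD2l [X in _ <= X]mulrDl; apply: lerD.
  by rewrite mulrAC.
rewrite ler_wpM2r ?invr_ge0 ?ler0n // ler_wpM2l // mulr_ge0 //.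
exact: log_kernel_bound_ge0.
Qed.

Section coloring.
Variables (n k : nat) (x : 'I_n -> R) (b : 'I_n -> 'I_k) (H : sgraph n).
Hypothesis xb : forall i, block k (b i) (x i).
Hypothesis WC : forall x y, I x -> I y -> W (x, y) = W (y, x).

Definition energy (T : {set 'I_n}) : R :=
  \sum_(i in T) \sum_(j in T | (i < j)%N) K (x i, x j).

Let Ix i : I (x i). Proof. exact: block_I (ltn_ord (b i)) (xb i). Qed.

(** The quadratic form counts each pair of [T] twice, whence [2 * energy T], and also the diagonal,
    where each vertex costs at most [L]. *)
Let quad_card_le (T : {set 'I_n}) :
  quad (@block_inf k) (fun a => #|[set i in T | b i == a]%SET|%:R) <=
  2 * energy T + L * #|T|%:R.
Proof.
have -> : quad (@block_inf k) (fun a => #|[set i in T | b i == a]%SET|%:R) =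
    \sum_(i in T) \sum_(j in T) block_inf (b i) (b j).
  have cardE a : #|[set i in T | b i == a]%SET|%:R = \sum_(i in T) (b i == a)%:R :> R.
    rewrite -sum1_card natr_sum big_mkcond [RHS]big_mkcond /=.
    by apply: eq_bigr => i _; rewrite inE; case: (i \in T); case: (b i == a).
  rewrite /quad.
  transitivity (\sum_a \sum_c \sum_(i in T) \sum_(j in T)
      ((b i == a)%:R * (b j == c)%:R * block_inf a c)).
    apply: eq_bigr => a _; apply: eq_bigr => c _; rewrite !cardE !mulr_suml.
    by apply: eq_bigr => i _; rewrite mulr_sumr mulr_suml.
  under eq_bigr => a _ do rewrite exchange_big /=.
  rewrite exchange_big /=; apply: eq_bigr => i _.
  under eq_bigr => a _ do rewrite exchange_big /=.
  rewrite exchange_big /=; apply: eq_bigr => j _.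
  rewrite (bigD1 (b i)) //= (bigD1 (b j)) //= !eqxx !mul1r.
  rewrite big1 => [|c cj]; last by rewrite eq_sym (negbTE cj) mulr0 mul0r.
  rewrite big1 ?addr0 // => a ai; rewrite big1 // => c _.
  by rewrite eq_sym (negbTE ai) !mul0r.
have KC i j : K (x i, x j) = K (x j, x i) by rewrite /K WC.
have -> : 2 * energy T + L * #|T|%:R =
    \sum_(i in T) (\sum_(j in T | (i < j)%N) K (x i, x j) +
                   \sum_(j in T | (j < i)%N) K (x i, x j) + L).
  rewrite !big_split /= sumr_const mulr_natr mulrDl mul1r; congr (_ + _ + _).
  rewrite /energy (exchange_big_dep (mem T)) /=; last by move=> i j _ /andP[].
  apply: eq_bigr => j jT; apply: eq_big => [i|i /andP[_ _]]; first by rewrite jT.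
  exact: KC.
apply: ler_sum => i iT; rewrite (bigID (fun j : 'I_n => (i < j)%N)) /= -addrA.
have wK j : block_inf (b i) (b j) <= K (x i, x j) by exact: block_inf_le.
apply: lerD; first by apply: ler_sum => j _; exact: wK.
rewrite (bigID (fun j : 'I_n => (j < i)%N)) /=; apply: lerD.
  rewrite (eq_bigl (fun j => (j \in T) && (j < i)%N)) => [|j].
    by apply: ler_sum => j _; exact: wK.
  by rewrite -andbA; congr (_ && _); case: ltngtP.
rewrite (big_pred1 i) => [|j].
  by apply: le_trans (wK i) _; apply: rlog_kernel_le.
rewrite -andbA -!leqNgt -eqn_leq; apply/andP/eqP => [[_ /eqP/val_inj->//]|->].
by rewrite iT.
Qed.

(** A corner of the box of a colour class is a union of blocks of that class, hence an independent
    set, to which the energy bound applies; [quad_le_corner] extends this to the whole box. *)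
Lemma phik_le_chromatic (c m E : R) :
  cover_bound k c ->
  0 < m -> (forall a, m <= #|[set i | b i == a]%SET|%:R) -> 0 <= E ->
  (forall T, independent H T -> energy T <= E * #|T|%:R) ->
  (phik k W <=
    ((chromatic_number H)%:R * (2 * E + L) / (k%:R * m) + c / k%:R)%:E)%E.
Proof.
move=> phikP m0 mb E0 indE.
have [f fP] := chromatic_number_coloring H.
rewrite -[chromatic_number H]card_ord.
pose cnt j (a : 'I_k) : R := #|[set i | (f i == j) && (b i == a)]%SET|%:R.
pose Nb (a : 'I_k) : R := #|[set i | b i == a]%SET|%:R.
have Nb0 a : 0 < Nb a by exact: lt_le_trans (mb a).
have cnt_sum a : \sum_j cnt j a = Nb a.
  rewrite /cnt /Nb -natr_sum; congr (_%:R).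
  rewrite -sum1_card (partition_big f xpredT) //=; apply: eq_bigr => j _.
  by rewrite sum1dep_card; apply: eq_card => i; rewrite !inE andbC.
(* Scaling down by [m / Nb a <= 1] gives every block the same total [m]; the scaled profile stays
   inside the box of the counts. *)
apply: (phikP _ (fun j a => m / Nb a * cnt j a) m) => //.
- by rewrite addr_ge0 ?mulr_ge0 // log_kernel_bound_ge0.
- by move=> j a; rewrite mulr_ge0 // divr_ge0 // ltW.
- by move=> a; rewrite -mulr_sumr cnt_sum divfK // gt_eqF.
move=> j t tp; apply: (quad_le_corner (s := cnt j)).
- by move=> a; exact: block_inf_ge0.
- by move=> a; rewrite ler0n.
- move=> A; pose t' (a : 'I_k) : R := if a \in A then cnt j a else 0.
  rewrite -[X in is_true X]/(quad (@block_inf k) t' <= (2 * E + L) * \sum_a t' a).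
  pose T := [set i | (f i == j) && (b i \in A)]%SET.
  have t'E : t' = (fun a => #|[set i in T | b i == a]%SET|%:R).
    apply/funext => a; rewrite /t'; case: ifPn => aA.
      congr (_%:R); apply: eq_card => i; rewrite !inE -andbA; congr (_ && _).
      by case: (b i =P a) => [->|]; rewrite ?aA ?andbF.
    symmetry; apply/eqP; rewrite pnatr_eq0 cards_eq0; apply/eqP/setP => i.
    rewrite !inE; case: (b i =P a) => [->|_]; last by rewrite andbF.
    by rewrite (negbTE aA) andbF.
  have -> : \sum_a t' a = #|T|%:R.
    rewrite t'E -natr_sum; congr (_%:R).
    rewrite -[RHS]sum1_card (partition_big b xpredT) //=; apply: eq_bigr => a _.
    by rewrite sum1dep_card; apply: eq_card => i; rewrite !inE.
  rewrite t'E; apply: le_trans (quad_card_le T) _; rewrite [X in _ <= X]mulrDl lerD2r -mulrA.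
  rewrite ler_pM2l //; apply: indE.
  apply/forall_inP => i; rewrite inE => /andP[/eqP fi _].
  apply/forall_inP => i'; rewrite inE => /andP[/eqP fi' _].
  by apply/negP => /fP; rewrite fi fi' eqxx.
- move=> a; have /andP[-> ta] /= := tp a; apply: le_trans ta _.
  by rewrite ler_piMl ?ler0n // ler_pdivrMr // mul1r; exact: mb.
Qed.

End coloring.
End log_kernel.

(** * First moment and concentration *)

Section bad_graphs.
Variables (R : realType) (W : R * R -> R) (s : R) (n : nat).
Variable x : n.-tuple (measurableTypeR R).
Local Notation I := (`[0, 1]%classic : set R).
Hypothesis W01 : forall x y, I x -> I y -> 0 <= W (x, y) <= s.
Hypothesis s1 : s < 1.
Hypothesis Ix : forall i, I (tnth x i).

Let en := energy W (tnth x).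

Definition bad_graph (E : R) (H : sgraph n) : bool :=
  [exists T : {set 'I_n}, independent H T && (E * #|T|%:R < en T)].

Lemma mass_independent (T : {set 'I_n}) :
  \sum_(H : sgraph n | independent H T) cond_mass W x H = expR (- en T).
Proof.
rewrite sum_cond_mass_independent /en /energy -sumrN expR_sum.
rewrite [RHS]big_mkcond; apply: eq_bigr => i _.
case: ifPn => iT; last by rewrite big1 // => j _; rewrite (negbTE iT).
rewrite -sumrN expR_sum big_mkcond [RHS]big_mkcond; apply: eq_bigr => j _.
case: (boolP (i < j)%N) => ij; rewrite ?andbF //= andbT; case: ifP => // jT.
rewrite /rlog_kernel opprK lnK // posrE.
exact: (one_sub_W_gt0 W01).
Qed.

Lemma sum_exp_card (r : R) : \sum_(T : {set 'I_n}) r ^+ #|T| = (1 + r) ^+ n.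
Proof.
rewrite addrC -[in RHS](card_ord n) -prodr_const bigA_distr; apply: eq_bigr => T _.
by rewrite -big_mkcond prodr_const.
Qed.

(** Union bound over [T]: a set of energy above [E * #|T|] is independent with probability at most
    [expR (- E) ^+ #|T|]. The empty set is never a witness, which accounts for the [- 1]. *)
Lemma mass_bad_graph E :
  \sum_(H : sgraph n | bad_graph E H) cond_mass W x H <= (1 + expR (- E)) ^+ n - 1.
Proof.
have W01' i j : 0 <= W (tnth x i, tnth x j) <= 1.
  have /andP[-> Ws] := W01 (Ix i) (Ix j); exact: le_trans Ws (ltW s1).
have cm0 H : 0 <= cond_mass W x H by exact: cond_mass_ge0.
apply: (@le_trans _ _ (\sum_(T : {set 'I_n} | E * #|T|%:R < en T)
    \sum_(H : sgraph n | independent H T) cond_mass W x H)).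
  rewrite [X in _ <= X](exchange_big_dep xpredT) //= big_mkcond /=.
  apply: ler_sum => H _; case: ifPn => [/existsP[T /andP[HT ET]]|_]; last first.
    by apply: sumr_ge0.
  rewrite (bigD1 T) /=; last by rewrite ET.
  by rewrite lerDl; apply: sumr_ge0.
rewrite -sum_exp_card [X in _ <= X - 1](bigD1 finset.set0) //= cards0 expr0 addrAC subrr add0r.
rewrite big_mkcond [X in _ <= X]big_mkcond; apply: ler_sum => T _.
case: ifPn => [ET|_]; last by case: ifP => // _; rewrite exprn_ge0 ?expR_ge0.
case: ifPn => [_|].
  by rewrite mass_independent -expRM_natr ler_expR mulNr lerN2 ltW.
rewrite negbK => /eqP T0; move: ET; rewrite T0 cards0 mulr0 /en /energy big1 ?ltxx //.
by move=> i; rewrite inE.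
Qed.

End bad_graphs.

Section iid.
Context d (T : measurableType d) (R : realType) (P : probability T R).
Local Open Scope ereal_scope.

(** Induction on [n]: Tonelli's theorem splits off the first sample. *)
Lemma integral_iid_prod (f : T -> R) n :
  measurable_fun setT f -> (forall x, (0 <= f x)%R) ->
  \int[iid_prob P n]_x (\prod_(i < n) f (tnth x i))%:E =
  (\int[P]_x (f x)%:E) ^+ n.
Proof.
move=> mf f0; elim: n => [|n IH].
  rewrite /= integral_dirac //; first by rewrite probability_setT mul1e big_ord0.
  apply/measurable_EFinP; under eq_fun do rewrite big_ord0.
  exact: measurable_cst.
have mprod m : measurable_fun [set: m.-tuple T]
    (fun x : m.-tuple T => (\prod_(i < m) f (tnth x i))%R).
  apply: measurable_prod => i _; apply: measurableT_comp => //.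
  exact: measurable_tnth.
have prod0 m (x : m.-tuple T) : (0 <= \prod_(i < m) f (tnth x i))%R.
  by apply: prodr_ge0.
have int0 : 0 <= \int[P]_x (f x)%:E by apply: integral_ge0 => x _; rewrite lee_fin.
have tconsE (z : T * n.-tuple T) : (\prod_(i < n.+1) f (tnth (tcons z) i) =
    f z.1 * \prod_(i < n) f (tnth z.2 i))%R.
  rewrite big_ord_recl tnth0; congr (_ * _)%R.
  by apply: eq_bigr => i _; rewrite tnthS.
have mprodE : measurable_fun [set: n.+1.-tuple T]
    (fun x : n.+1.-tuple T => (\prod_(i < n.+1) f (tnth x i))%:E).
  by apply/measurable_EFinP; exact: mprod.
rewrite [iid_prob P n.+1]/= /distribution (ge0_integral_pushforward (@measurable_tcons _ T n) _
  measurableT mprodE); last by move=> x _; rewrite lee_fin.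
rewrite preimage_setT /comp; under eq_integral do rewrite tconsE.
have mcons : measurable_fun [set: T * n.-tuple T]
    (fun z => (f z.1 * \prod_(i < n) f (tnth z.2 i))%:E).
  apply/measurable_EFinP; apply: measurable_funM; first exact: measurableT_comp.
  exact: (measurableT_comp (mprod n)).
rewrite (fubini_tonelli1 _ mcons); last by move=> z; rewrite lee_fin mulr_ge0.
transitivity (\int[P]_x ((\int[P]_x (f x)%:E) ^+ n * (f x)%:E)).
  apply: eq_integral => x _; rewrite /fubini_F /=.
  under eq_integral do rewrite EFinM.
  have mE : measurable_fun [set: n.-tuple T]
      (fun y => (\prod_(i < n) f (tnth y i))%:E).
    by apply/measurable_EFinP; exact: mprod.
  rewrite (ge0_integralZl_EFin _ measurableT _ mE) //; last by move=> y _; rewrite lee_fin.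
  by rewrite IH muleC.
have mfE : measurable_fun [set: T] (EFin \o f) by exact/measurable_EFinP.
rewrite (ge0_integralZl _ measurableT mfE) //; first by rewrite expeS muleC.
  by move=> x _; rewrite lee_fin.
by rewrite expe_ge0.
Qed.

End iid.

(** * Concentration of the block counts *)

Section concentration.
Variable R : realType.
Local Notation I := (`[0, 1]%classic : set R).
Local Notation P := (lambda01 R).
Local Notation T := (measurableTypeR R).

Definition block_count n k a (x : n.-tuple T) : R :=
  \sum_(i < n) \1_(block k a) (tnth x i).

Lemma measurable_block_count n k a :
  measurable_fun setT (@block_count n k a).
Proof.
apply: measurable_sum => i; apply: measurableT_comp; last exact: measurable_tnth.
by apply: measurable_indic; exact: measurable_block.
Qed.

Lemma measurable_block_count_lt n k a (m : R) :
  measurable [set x : n.-tuple T | block_count k a x < m].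
Proof.
have := @measurable_block_count n k a measurableT _ (measurable_itv `]-oo, m[).
rewrite setTI; congr measurable; apply/seteqP; split => x /=; by rewrite in_itv.
Qed.

(** The Laplace transform at [del] of a Bernoulli variable of parameter [1 / k]. *)
Lemma integral_expR_block k (a : 'I_k) (del : R) :
  (\int[P]_x (expR (- del * \1_(block k a) x))%:E =
   (1 - (1 - expR (- del)) / k%:R)%:E)%E.
Proof.
have mB := @measurable_block R k a.
transitivity (\int[P]_x ((expR (- del))%:E * (\1_(block k a) x)%:E +
    (\1_(~` block k a) x)%:E))%E.
  apply: eq_integral => x _; rewrite -EFinM -EFinD; congr EFin.
  rewrite !indicE in_setC; case: (x \in block k a) => /=.
    by rewrite !mulr1 addr0.
  by rewrite !mulr0 expR0 add0r.
have m1 : measurable_fun setT (fun x : T => (\1_(block k a) x)%:E : \bar R).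
  by apply/measurable_EFinP; exact: measurable_indic.
have m2 : measurable_fun setT (fun x : T => (\1_(~` block k a) x)%:E : \bar R).
  by apply/measurable_EFinP; apply: measurable_indic; exact: measurableC.
have m3 : measurable_fun setT
    (fun x : T => (expR (- del))%:E * (\1_(block k a) x)%:E : \bar R)%E.
  exact: measurable_funeM.
rewrite ge0_integralD //.
rewrite (ge0_integralZl_EFin _ measurableT _ m1) ?expR_ge0 //.
rewrite (integral_indic _ measurableT mB) (integral_indic _ measurableT (measurableC mB)).
have PB : P (block k a) = (k%:R^-1)%:E by exact: lambda01_block.
have PC : P (~` block k a) = (1 - k%:R^-1)%:E.
  by rewrite EFinB -PB; exact: probability_setC.
rewrite !setIT [X in (_ * X)%E]PB [X in (_ + X)%E]PC.
by rewrite -EFinM -EFinD; congr EFin; ring.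
Qed.

(** Chernoff's bound with the deviation [del] itself as exponential parameter. With
    [expR (- del) <= 1 / (1 + del)], the exponent per sample is
    [(del * (1 - del) - del / (1 + del)) / k], that is, [- del ^+ 3 / (1 + del) / k]. *)
Lemma block_count_concentration n k (a : 'I_k) (del : R) : 0 < del ->
  (iid_prob P n [set x | (block_count k a x < (1 - del) * n%:R / k%:R)%R]
    <= (expR (- (del ^+ 3 / (1 + del) / k%:R)) ^+ n)%:E)%E.
Proof.
move=> d0; set m := (1 - del) * n%:R / k%:R; set A := (X in (iid_prob P n X <= _)%E).
have mA : measurable A by exact: measurable_block_count_lt.
have k0 : 0 < k%:R :> R by rewrite ltr0n (leq_ltn_trans _ (ltn_ord a)).
pose f (x : T) := expR (- del * \1_(block k a) x).
have mf : measurable_fun setT f.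
  apply: measurableT_comp; first exact: measurable_expR.
  by apply: measurable_funM => //; apply: measurable_indic; exact: measurable_block.
have f0 x : 0 <= f x by exact: expR_ge0.
rewrite -[A]setIT -integral_indic //.
(* Markov's inequality: on [A] the exponential of [del * (m - block_count k a x)] is at least 1. *)
apply: (@le_trans _ _ (\int[iid_prob P n]_x
    ((expR (del * m))%:E * (\prod_(i < n) f (tnth x i))%:E))%E).
  apply: ge0_le_integral_pointwise => x _; rewrite !lee_fin ler0n /=.
  rewrite /f -expR_sum -expRD -mulr_sumr -/(block_count k a x) mulNr -mulrBr indicE.
  case: (boolP (x \in A)) => [|_]; last exact: expR_ge0.
  rewrite inE => Ax; apply: le_trans (expR_ge1Dx _).
  by rewrite lerDl mulr_ge0 ?subr_ge0 // ltW.
have mprod : measurable_fun [set: n.-tuple T]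
    (fun x : n.-tuple T => (\prod_(i < n) f (tnth x i))%:E).
  apply/measurable_EFinP; apply: measurable_prod => i _.
  by apply: measurableT_comp => //; exact: measurable_tnth.
rewrite (ge0_integralZl_EFin _ measurableT _ mprod) ?expR_ge0 //; last first.
  by move=> x _; rewrite lee_fin prodr_ge0.
rewrite integral_iid_prod // integral_expR_block -EFin_expe -EFinM lee_fin.
have -> : expR (del * m) = expR (del * (1 - del) / k%:R) ^+ n.
  by rewrite -expRM_natr /m; congr expR; ring.
rewrite -exprMn; apply: lerXn2r; rewrite ?nnegrE ?expR_ge0 //.
  rewrite mulr_ge0 ?expR_ge0 // subr_ge0 ler_pdivrMr // mul1r.
  apply: (@le_trans _ _ 1); last by rewrite ler1n -(ltr0n R).
  by rewrite gerBl expR_ge0.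
have e_le : expR (- del) <= 1 / (1 + del).
  rewrite expRN div1r lef_pV2 ?posrE ?expR_gt0 ?expR_ge1Dx //; lra.
apply: (@le_trans _ _ (expR (del * (1 - del) / k%:R) * expR (- (del / (1 + del) / k%:R)))).
  rewrite ler_pM2l ?expR_gt0 //; apply: le_trans (expR_ge1Dx _).
  rewrite lerD2l lerN2 ler_pM2r ?invr_gt0 //.
  have -> : del / (1 + del) = 1 - 1 / (1 + del) by field; lra.
  by rewrite lerD2l lerN2.
rewrite -expRD ler_expR le_eqVlt; apply/orP; left; apply/eqP.
field; rewrite gt_eqF //=; lra.
Qed.

Lemma measurable_unit_sample n :
  measurable [set x : n.-tuple T | forall i, I (tnth x i)].
Proof.
have mI : measurable (I : set T) by exact: measurable_itv.
rewrite (_ : [set x | _] = \bigcap_(i in [set: 'I_n]) ((@tnth n T)^~ i @^-1` I)).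
  apply: fin_bigcap_measurable => // i _; rewrite -[X in measurable X]setTI.
  exact: measurable_tnth.
by apply/seteqP; split => x /= xI i; [move=> _; exact: xI|exact: (xI i Logic.I)].
Qed.

Lemma iid_prob_unit n :
  iid_prob P n [set x | forall i, I (tnth x i)] = 1%E.
Proof.
have mI : measurable (I : set T) by exact: measurable_itv.
have mD := @measurable_unit_sample n.
rewrite -[X in iid_prob P n X]setIT -integral_indic //.
transitivity (\int[iid_prob P n]_x (\prod_(i < n) \1_I (tnth x i))%:E)%E.
  apply: eq_integral => x _; congr EFin; rewrite indicE.
  case: (boolP (x \in _)) => [|].
    rewrite inE => xI; rewrite big1 // => i _; rewrite indicE mem_set //; exact: xI.
  rewrite notin_setE /= => /existsNP[i xi].
  by rewrite (bigD1 i) //= indicE memNset // mul0r.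
rewrite (integral_iid_prod P (f := \1_I)) //.
  have PI : P I = 1%E by rewrite -[I]setTI lambda01_setI; exact: probability_setT.
  by rewrite integral_indic // setIT [X in (X ^+ n)%E]PI -EFin_expe expr1n.
Qed.

Definition good_sample n k (del : R) : set (n.-tuple T) :=
  [set x | (forall i, I (tnth x i)) /\
           forall a : 'I_k, (1 - del) * n%:R / k%:R <= block_count k a x].

Definition sparse_sample n k (del : R) (a : nat) : set (n.-tuple T) :=
  [set x | block_count k a x < (1 - del) * n%:R / k%:R].

Arguments good_sample n k del : clear implicits.
Arguments sparse_sample n k del a : clear implicits.

Lemma good_sampleE n k del : good_sample n k del =
  [set x | forall i, I (tnth x i)] `\` \big[setU/set0]_(a < k) sparse_sample n k del a.
Proof.
rewrite -bigcup_seq; apply/seteqP; split => x [/= xI xa]; split => //.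
  by move=> [a _]; rewrite /sparse_sample /= ltNge xa.
by move=> a; rewrite leNgt; apply/negP => ?; apply: xa; exists a => //=; rewrite mem_index_enum.
Qed.

Lemma measurable_good_sample n k del : measurable (good_sample n k del).
Proof.
rewrite good_sampleE; apply: measurableD; first exact: measurable_unit_sample.
by apply: bigsetU_measurable => a _; exact: measurable_block_count_lt.
Qed.

Lemma good_sample_prob n k (del : R) : 0 < del ->
  ((1 - k%:R * expR (- (del ^+ 3 / (1 + del) / k%:R)) ^+ n)%:E
    <= iid_prob P n (good_sample n k del))%E.
Proof.
move=> d0; set e := expR _ ^+ n.
pose F := \big[setU/set0]_(a < k) sparse_sample n k del a.
have mF : measurable F.
  by apply: bigsetU_measurable => a _; exact: measurable_block_count_lt.
have FE : (iid_prob P n F <= (k%:R * e)%:E)%E.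
  apply: (@le_trans _ _ (\sum_(a < k) iid_prob P n (sparse_sample n k del a))%E).
    by apply: Boole_inequality => a _; exact: measurable_block_count_lt.
  rewrite -[k in k%:R]card_ord -sum1_card natr_sum mulr_suml -sumEFin.
  by apply: lee_sum => a _; rewrite mul1r; exact: block_count_concentration.
rewrite EFinB leeBlDr //; apply: le_trans (leeD2l _ FE).
rewrite -(iid_prob_unit n); apply: le_trans (measureU2 _ _ mF).
  apply: le_measure; rewrite ?inE.
  - exact: measurable_unit_sample.
  - by apply: measurableU => //; exact: measurable_good_sample.
  - by rewrite good_sampleE -/F => x xI; have [Fx|Fx] := pselect (F x); [right|left].
exact: measurable_good_sample.
Qed.

End concentration.

(** * The lower bound for a given number of vertices *)

Section lower_bound.
Variables (R : realType) (W : R * R -> R) (s c : R) (k : nat).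
Local Notation I := (`[0, 1]%classic : set R).
Local Notation L := (- ln (1 - s)).
Hypothesis W01 : forall x y, I x -> I y -> 0 <= W (x, y) <= s.
Hypothesis s1 : s < 1.
Hypothesis WC : forall x y, I x -> I y -> W (x, y) = W (y, x).
Hypothesis k0 : (0 < k)%N.
Hypothesis phikP : cover_bound W k c.

Let L0 : 0 <= L. Proof. exact: log_kernel_bound_ge0 W01 s1. Qed.
Let kR : 0 < k%:R :> R. Proof. by rewrite ltr0n. Qed.

(** A single class with uniform profile and [V = L]. This crude bound settles the case of a large
    chromatic number. *)
Lemma phik_le_log : (phik k W <= (L + c / k%:R)%:E)%E.
Proof.
have kinv0 : 0 < k%:R^-1 :> R by rewrite invr_gt0.
have := @phikP unit (fun _ _ => k%:R^-1) k%:R^-1 L kinv0 L0.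
rewrite card_unit mul1r divff ?gt_eqF // divr1; apply.
- by move=> _ _; exact: ltW.
- by move=> a; rewrite big_const card_unit /= addr0.
move=> _ t tk; have t0 a : 0 <= t a by have /andP[] := tk a.
have T0 : 0 <= \sum_a t a by exact: sumr_ge0.
have T1 : \sum_a t a <= 1.
  apply: (@le_trans _ _ (\sum_(a < k) k%:R^-1)).
    by apply: ler_sum => a _; have /andP[] := tk a.
  by rewrite sumr_const card_ord -[_ *+ k]mulr_natl divff // gt_eqF.
apply: (@le_trans _ _ (L * ((\sum_a t a) * \sum_a t a))).
  rewrite /quad mulr_suml mulr_sumr; apply: ler_sum => a _.
  rewrite mulr_sumr mulr_sumr; apply: ler_sum => b _.
  rewrite mulrC ler_wpM2r ?mulr_ge0 //.
  have ka := block_left R (ltn_ord a); have kb := block_left R (ltn_ord b).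
  apply: le_trans (block_inf_le W01 ka kb) _.
  by apply: (rlog_kernel_le W01 s1); [exact: block_I ka|exact: block_I kb].
by rewrite ler_wpM2l // ler_piMl.
Qed.

(** Chosen so that a relative error [eta] on a quantity at most [L + 1] costs at most [1 / k]. The
    choice [eps = eta / 4] then ensures [1 + 2 * eps <= (1 + eta) * (1 - eps)]. *)
Let eta : R := (k%:R * (L + 1))^-1.
Let eps : R := eta / 4.

Let eta0 : 0 < eta. Proof. by rewrite invr_gt0 mulr_gt0 // ltr_wpDl. Qed.
Let eta1 : eta <= 1.
Proof.
rewrite invf_le1 ?mulr_gt0 ?ltr_wpDl //.
by rewrite mulr_ege1 ?lerDr // ler1n.
Qed.
Let eps0 : 0 < eps. Proof. by rewrite divr_gt0. Qed.
Let eps1 : eps < 1. Proof. by rewrite /eps; have := eta1; lra. Qed.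

(** The deterministic part, with [y] the right-hand side. If [y <= L + 1], the relative errors from
    [eps] and from the term [L] cost at most [1 / k]; if [y] is larger, [phik_le_log] suffices. *)
Lemma phik_le_not_bad n (x : n.-tuple (measurableTypeR R)) (H : sgraph n) :
  L / (2 * eps) <= ln n%:R -> 0 < ln n%:R :> R ->
  good_sample k eps x -> ~~ bad_graph W x ((1 + eps) * ln n%:R) H ->
  (phik k W - ((c + 1) / k%:R)%:E <=
   ((chromatic_number H)%:R * (2 * ln n%:R / n%:R))%:E)%E.
Proof.
move=> Ln ln0 [xI xcnt] Hbad.
have n0 : 0 < n%:R :> R.
  by rewrite ltr0n lt0n; apply/eqP => n0; move: ln0; rewrite n0 ln0 ?ltxx.
set l : R := ln n%:R in Ln ln0 Hbad *.
have /choice[b xb] (i : 'I_n) : exists a : 'I_k, block k a (tnth x i).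
  exact: block_cover.
have cntE (a : 'I_k) : block_count k a x = #|[set i | b i == a]%SET|%:R.
  rewrite /block_count -sum1dep_card natr_sum [RHS]big_mkcond /=.
  apply: eq_bigr => i _; rewrite indicE; case: eqVneq => [<-|bia].
    by rewrite mem_set.
  rewrite memNset // => xa.
  have /trivIsetP/(_ (b i) a Logic.I Logic.I bia) := @trivIset_block R k.
  by move/seteqP => [/(_ (tnth x i)) h _]; exact: h.
have m0 : 0 < (1 - eps) * n%:R / k%:R.
  by rewrite !mulr_gt0 ?invr_gt0 // subr_gt0.
have E0 : 0 <= (1 + eps) * l by rewrite mulr_ge0 ?addr_ge0 // ltW.
have := @phik_le_chromatic _ _ _ W01 s1 n k (tnth x) b H xb WC c _ _ phikP m0 _ E0 _.
set chi : R := (chromatic_number H)%:R.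
have chi0 : 0 <= chi by exact: ler0n.
set y := chi * (2 * l / n%:R).
have y0 : 0 <= y by rewrite mulr_ge0 // divr_ge0 ?mulr_ge0 // ltW.
move=> phi1.
have {}phi1 : (phik k W <= (y * (1 + eta) + c / k%:R)%:E)%E.
  apply: le_trans (phi1 _ _) _.
  - by move=> a; rewrite -cntE; exact: xcnt.
  - move=> T HT; move: Hbad; rewrite negb_exists => /forallP/(_ T).
    by rewrite HT /= -leNgt.
  rewrite lee_fin lerD2r.
  have -> : chi * (2 * ((1 + eps) * l) - ln (1 - s)) / (k%:R * ((1 - eps) * n%:R / k%:R)) =
      chi / n%:R * ((2 * ((1 + eps) * l) + L) / (1 - eps)).
    by field; rewrite !gt_eqF // subr_gt0.
  have -> : y * (1 + eta) = chi / n%:R * (2 * l * (1 + eta)).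
    by rewrite /y; field; rewrite gt_eqF.
  rewrite ler_wpM2l ?divr_ge0 ?(ltW n0) // ler_pdivrMr ?subr_gt0 //.
  (* For large [n] the diagonal term [L] is absorbed into the relative error. *)
  have Ll : L <= 2 * eps * l by rewrite mulrC -ler_pdivrMr // mulr_gt0.
  apply: (@le_trans _ _ (2 * l * (1 + 2 * eps))); first by lra.
  rewrite -[X in _ <= X]mulrA ler_pM2l ?mulr_gt0 //.
  have -> : (1 + eta) * (1 - eps) = 1 + 2 * eps + eta * (1 - eta) / 4.
    by rewrite /eps; field.
  by rewrite lerDl divr_ge0 // mulr_ge0 // ?subr_ge0 // ltW.
rewrite leeBlDr // -EFinD.
have [yL|yL] := leP y (L + 1).
  apply: le_trans phi1 _; rewrite lee_fin.
  have : y * eta <= k%:R^-1.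
    rewrite /eta invfM mulrCA ler_piMr ?invr_ge0 ?(ltW kR) //.
    by rewrite ler_pdivrMr ?mul1r // ltr_wpDl.
  by rewrite [(c + 1) / _]mulrDl mul1r; lra.
apply: le_trans phik_le_log _; rewrite lee_fin [(c + 1) / _]mulrDl mul1r.
have : 0 < k%:R^-1 :> R by rewrite invr_gt0.
lra.
Qed.

(** For positive [n] the inner exponential is [n ^ (- eps)]; the whole bounds
    [(1 + n ^ (- (1 + eps))) ^ n - 1], the first-moment estimate. *)
Definition error_bound n : R := expR (expR (- (eps * ln n%:R))) - 1.

Lemma mass_bad_graph_le n (x : n.-tuple (measurableTypeR R)) : (0 < n)%N ->
  (forall i, I (tnth x i)) ->
  \sum_(H : sgraph n | bad_graph W x ((1 + eps) * ln n%:R) H) cond_mass W x H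
    <= error_bound n.
Proof.
move=> n0 xI; apply: le_trans (mass_bad_graph W01 s1 xI _) _.
have nR : 0 < n%:R :> R by rewrite ltr0n.
rewrite lerD2r -[X in _ <= expR X](_ : n%:R * expR (- ((1 + eps) * ln n%:R)) = _).
  rewrite expRM_natl; apply: lerXn2r; rewrite ?nnegrE ?addr_ge0 ?expR_ge0 //.
  exact: expR_ge1Dx.
rewrite -{1}[n%:R]lnK ?posrE // -expRD; congr expR; ring.
Qed.

Lemma Gnw_prob_le1 n (A : {set sgraph n}) : (Gnw_prob W A <= 1)%E.
Proof.
rewrite /Gnw_prob -(iid_prob_unit R n).
have mD := @measurable_unit_sample R n.
set D := [set x | _] in mD *.
rewrite -[X in (_ <= X)%E]mul1e -(integral_cst (iid_prob (lambda01 R) n) mD 1%E).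
apply: ge0_le_integral_pointwise => x xI; rewrite !lee_fin.
have W1 i j : 0 <= W (tnth x i, tnth x j) <= 1.
  by have /andP[-> Ws] := W01 (xI i) (xI j); exact: le_trans Ws (ltW s1).
have cm0 H : 0 <= cond_mass W x H by exact: cond_mass_ge0.
rewrite sumr_ge0 //= -(sum_cond_mass W x) [X in _ <= X](bigID (mem A)) /=.
by rewrite lerDl sumr_ge0.
Qed.

(** Conditionally on a good sample, every graph outside [A] is bad, so [A] has mass at least
    [1 - error_bound n]; this is integrated over the good samples. *)
Lemma Gnw_prob_ge n (A : {set sgraph n}) : (0 < n)%N -> error_bound n <= 1 ->
  (forall (x : n.-tuple (measurableTypeR R)) H, good_sample k eps x ->
     ~~ bad_graph W x ((1 + eps) * ln n%:R) H -> H \in A) ->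
  (((1 - error_bound n) *
     (1 - k%:R * expR (- (eps ^+ 3 / (1 + eps) / k%:R)) ^+ n))%:E <= Gnw_prob W A)%E.
Proof.
move=> n0 err1 goodA.
have mD := @measurable_unit_sample R n.
have mG := @measurable_good_sample R n k eps.
have err0 : 0 <= 1 - error_bound n by rewrite subr_ge0.
rewrite EFinM; apply: le_trans (lee_wpmul2l _ (good_sample_prob n k eps0)) _.
  by rewrite lee_fin.
have -> : ((1 - error_bound n)%:E * iid_prob (lambda01 R) n (good_sample k eps) =
    \int[iid_prob (lambda01 R) n]_(x in [set x | forall i, I (tnth x i)])
      ((1 - error_bound n)%:E * (\1_(good_sample k eps) x)%:E))%E.
  have m1 : measurable_fun [set x : n.-tuple (measurableTypeR R) | forall i, I (tnth x i)]
      (fun x => (\1_(good_sample k eps) x)%:E : \bar R).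
    by apply/measurable_EFinP; exact: measurable_indic.
  rewrite (ge0_integralZl_EFin _ mD _ m1) //.
  rewrite (integral_indic _ mD mG); congr (_ * iid_prob (lambda01 R) n _)%E.
  by apply/esym/setIidl => x [].
apply: ge0_le_integral_pointwise => x xI; rewrite !lee_fin mulr_ge0 //=.
have W1 i j : 0 <= W (tnth x i, tnth x j) <= 1.
  by have /andP[-> Ws] := W01 (xI i) (xI j); exact: le_trans Ws (ltW s1).
have cm0 H : 0 <= cond_mass W x H by exact: cond_mass_ge0.
rewrite indicE; case: (boolP (x \in _)) => [|_]; last first.
  by rewrite mulr0 sumr_ge0.
rewrite inE => gx; rewrite mulr1 lerBlDr.
rewrite -(sum_cond_mass W x) (bigID (mem A)) /= lerD2l.
apply: le_trans (mass_bad_graph_le n0 xI).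
rewrite big_mkcond [X in _ <= X]big_mkcond; apply: ler_sum => H _.
case: ifPn => HA; last by case: ifP.
by case: ifPn => // /(goodA _ _ gx); rewrite (negbTE HA).
Qed.

End lower_bound.

(** * Passage to the limit *)

Section limits.
Variable R : realType.

Lemma near_ln_ge (A : R) : \forall n \near \oo, A <= ln n%:R.
Proof.
near=> n; rewrite -[A]expRK; have An : expR A <= n%:R by near: n; exact: nbhs_infty_ger.
by rewrite ler_ln ?posrE ?expR_gt0 // (lt_le_trans _ An) ?expR_gt0.
Unshelve. all: by end_near. Qed.

Lemma cvg_error_bound (s : R) (k : nat) : (0 < k)%N -> 0 <= - ln (1 - s) ->
  error_bound s k n @[n --> \oo] --> (0 : R).
Proof.
move=> k0 L0.
have ep : 0 < (k%:R * (- ln (1 - s) + 1))^-1 / 4 :> R.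
  by rewrite divr_gt0 // invr_gt0 mulr_gt0 ?ltr0n // ltr_wpDl.
rewrite /error_bound -[X in _ --> X](subrr 1); apply: cvgB; last exact: cvg_cst.
rewrite -[X in _ --> X]expR0.
apply: continuous_cvg; first exact: continuous_expR.
apply: (cvg_comp (fun n : nat => _ * ln n%:R) (fun x => expR (- x))); last exact: cvgr_expR.
apply/cvgryPge => A; near=> n; rewrite mulrC -ler_pdivrMr //.
by near: n; exact: near_ln_ge.
Unshelve. all: by end_near. Qed.

End limits.

Theorem theorem2p13 (R : realType) (W : R * R -> R) :
  graphon W ->
  sup [set W z | z in `[0, 1] `*` `[0, 1]] < 1 ->
  block_increasing W \/ block_lipschitz W ->
  exists2 c : R, 0 < c &
    forall k : nat, (0 < k)%N ->
      Gnw_prob W [set H : sgraph n |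
          ((phik k W - (c / k%:R)%:E) * (n%:R / (2 * ln n%:R))%:E
             <= (chromatic_number H)%:R%:E)%E]%SET
        @[n --> \oo] --> 1%E.
Proof.
move=> [_ WC W01] s1 Wreg; set s := sup _ in s1.
have {}W01 x y : (`[0, 1]%classic : set R) x -> (`[0, 1]%classic : set R) y ->
    0 <= W (x, y) <= s.
  move=> Ix Iy; have /andP[-> _] := W01 x y Ix Iy; apply: ub_le_sup.
    exists 1 => _ [[x' y'] [/= Ix' Iy'] <-].
    by have /andP[] := W01 x' y' Ix' Iy'.
  by exists (x, y).
have [c [c0 phikP]] := phik_le_weights W01 s1 Wreg.
(* The extra 1 is the cost of the relative error in [phik_le_not_bad]; it also makes the constant
   positive. *)
exists (c + 1); first by rewrite ltr_wpDl.
move=> k k0; have {}phikP := phikP k k0.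
have L0 := log_kernel_bound_ge0 W01 s1.
set eps : R := (k%:R * (- ln (1 - s) + 1))^-1 / 4.
have eps0 : 0 < eps.
  by rewrite divr_gt0 // invr_gt0 mulr_gt0 ?ltr0n // ltr_wpDl.
set r : R := expR (- (eps ^+ 3 / (1 + eps) / k%:R)).
have r1 : `|r| < 1.
  rewrite ger0_norm ?expR_ge0 // expR_lt1 oppr_lt0 !divr_gt0 ?ltr0n ?exprn_gt0 //.
  by rewrite addr_gt0.
have err0 := cvg_error_bound k0 L0.
(* For large [n] the probability lies between the bound of [Gnw_prob_ge] and 1; here [eps] and [r]
   spell out the quantities of that bound. *)
apply: (@squeeze_cvge _ _ _ _
  (fun n => ((1 - error_bound s k n) * (1 - k%:R * r ^+ n))%:E) _ (fun=> 1%E)); last 2 first.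
- apply: cvg_EFin; first by near=> n.
  have cvg1 : (fun=> 1 : R) n @[n --> \oo] --> (1 : R) by exact: cvg_cst.
  have cvgr : k%:R * r ^+ n @[n --> \oo] --> (k%:R * 0 : R).
    by apply: cvgM; [exact: cvg_cst|exact: cvg_expr].
  have := cvgM (cvgB cvg1 err0) (cvgB cvg1 cvgr).
  by rewrite mulr0 !subr0 mulr1; apply.
- exact: cvg_cst.
near=> n; apply/andP; split; last exact: Gnw_prob_le1 W01 s1 _ _.
have ln_ge : - ln (1 - s) / (2 * eps) <= ln n%:R by near: n; exact: near_ln_ge.
have ln1 : 1 <= ln n%:R :> R by near: n; exact: near_ln_ge.
have ln0 : 0 < ln n%:R :> R by exact: lt_le_trans ltr01 ln1.
have n0 : (0 < n)%N by near: n; exact: nbhs_infty_gt.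
have nR : 0 < n%:R :> R by rewrite ltr0n.
apply: (Gnw_prob_ge W01 s1 k0 n0).
  by near: n; apply: (cvgr_le _ err0); exact: ltr01.
move=> x H gx Hbad; rewrite inE.
have q0 : (0 <= (n%:R / (2 * ln n%:R))%:E :> \bar R)%E.
  by rewrite lee_fin divr_ge0 ?mulr_ge0 // ltW.
(* The multiplier is the inverse of [2 * ln n / n], so the chromatic number remains alone on the
   right. *)
have := lee_wpmul2r q0 (phik_le_not_bad W01 s1 WC k0 phikP ln_ge ln0 gx Hbad).
rewrite -EFinM -[(_ * (2 * _ / _) * _)]mulrA.
suff -> : 2 * ln n%:R / n%:R * (n%:R / (2 * ln n%:R)) = 1 :> R by rewrite mulr1.
by field; rewrite !gt_eqF.
Unshelve. all: by end_near. Qed.
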